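(* Consider the equation $$\lambda_{xxxy}-\lambda_{xyyy}=\varepsilon\,\mathcal{Q}(\lambda,\lambda),$$ where for functions $u,v$ of $(x,y)$ $$\mathcal{Q}(u,v)=u_{xy}(v_{yyyy}-v_{xxxx})+3(u_{yyy}v_{xyy}-u_{xxx}v_{xxy})+2(u_{yy}v_{xyyy}-u_{xx}v_{xxxy}),$$ and look for a formal solution $\lambda=\sum_{k\ge0}\lambda_k\varepsilon^k$, i.e. $(\lambda_k)_{xxxy}-(\lambda_k)_{xyyy}=\sum_{p+q=k-1,\ p,q\ge0}\mathcal{Q}(\lambda_p,\lambda_q)$ for $k\ge1$. Let $$\lambda_0=\sum_{m\ge1}\alpha_m(\cos mx+\cos my)+\sum_{m\ge1}\beta_m(\cos m(x-y)+\cos m(x+y)),$$ and for each $k\ge1$ let $\tilde\lambda_k=\sum_{m\ge1}\alpha^k_m(\cos mx+\cos my)+\sum_{m\ge1}\beta^k_m(\cos m(x-y)+\cos m(x+y))$, where all coefficient sequences are real and decay faster than any power of $m$. Then one can inductively define, for every $k\ge1$, a smooth $2\pi\mathbb{Z}^2$-periodic function $\lambda_k$ solving the $k$-th recursion equation, namely $\lambda_k=\mu_k+\tilde\lambda_k$ where $\mu_k$ is the unique smooth periodic solution whose Fourier coefficients at all modes $e^{i(mx+ny)}$ with $mn(m^2-n^2)=0$ vanish: at each step the right-hand side $\sum_{p+q=k-1}\mathcal{Q}(\lambda_p,\lambda_q)$ is a smooth periodic function with vanishing Fourier coefficients at all modes $e^{imx},e^{imy},e^{im(x+y)},e^{im(x-y)}$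 ($m\in\mathbb{Z}$), and every $\lambda_k$ is invariant under $(x,y)\mapsto(-x,y)$, $(x,y)\mapsto(x,-y)$ and $(x,y)\mapsto(y,x)$.
   Context: This equation is the equation $\lambda_{xy}(\lambda_{yyyy}-\lambda_{xxxx})+3(\lambda_{yyy}\lambda_{xyy}-\lambda_{xxy}\lambda_{xxx})+2(\lambda_{yy}\lambda_{xyyy}-\lambda_{xx}\lambda_{xxxy})+4a_{22}\lambda_{xyyy}-4a_{11}\lambda_{xxxy}+2a_{12}(\lambda_{yyyy}-\lambda_{xxxx})=0$ for $a_{12}=0$, $a_{11}=a_{22}=\frac{1}{4\varepsilon}$, multiplied by $\varepsilon$. Periodicity refers to the lattice $2\pi\mathbb{Z}^2$ (the paper writes the integer lattice with period $2\pi$ in trigonometric form). The operator $\partial_x\partial_y(\partial_x^2-\partial_y^2)$ acts on $e^{i(mx+ny)}$ by multiplication by $mn(m^2-n^2)$. *)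

(* Defs.v *)
From Stdlib Require Import Reals ZArith.
Open Scope R_scope.

Definition cont2 (f : R -> R -> R) : Prop :=
  forall x y eps, 0 < eps -> exists delta, 0 < delta /\
    forall x' y', Rabs (x' - x) < delta -> Rabs (y' - y) < delta ->
      Rabs (f x' y' - f x y) < eps.

(* F i j is the partial derivative d_x^i d_y^j of F 0 0; F 0 0 is smooth
   (all partial derivatives exist everywhere and are jointly continuous). *)
Definition smooth_family (F : nat -> nat -> R -> R -> R) : Prop :=
  forall i j,
    (forall x y, derivable_pt_lim (fun t => F i j t y) x (F (S i) j x y)) /\
    (forall x y, derivable_pt_lim (fun t => F i j x t) y (F i (S j) x y)) /\
    cont2 (F i j).

Definition periodic2 (f : R -> R -> R) : Prop :=
  forall x y, f (x + 2 * PI) y = f x y /\ f x (y + 2 * PI) = f x y.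

Definition is_integral (g : R -> R) (a b v : R) : Prop :=
  exists pr : Riemann_integrable g a b, RiemannInt pr = v.

Definition is_integral2 (h : R -> R -> R) (v : R) : Prop :=
  exists g : R -> R,
    (forall x, is_integral (fun y => h x y) 0 (2 * PI) (g x)) /\
    is_integral g 0 (2 * PI) v.

(* the Fourier coefficient of f at the mode e^{i(mx+ny)} vanishes
   (real and imaginary parts of the integral of f * e^{-i(mx+ny)}) *)
Definition fourier_zero (f : R -> R -> R) (m n : Z) : Prop :=
  is_integral2 (fun x y => f x y * cos (IZR m * x + IZR n * y)) 0 /\
  is_integral2 (fun x y => f x y * sin (IZR m * x + IZR n * y)) 0.

Definition resonant (m n : Z) : Prop := (m * n * (m * m - n * n) = 0)%Z.

Definition rapid_decay (a : nat -> R) : Prop :=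
  forall p : nat, exists C, forall m : nat, Rabs (a m) * INR m ^ p <= C.

(* f = sum_{m>=1} a_m (cos mx + cos my) + sum_{m>=1} b_m (cos m(x-y) + cos m(x+y));
   coefficients a m, b m are used for m >= 1 (index 0 ignored). *)
Definition is_cos_series (a b : nat -> R) (f : R -> R -> R) : Prop :=
  forall x y, exists s1 s2,
    infinite_sum (fun m => a (S m) * (cos (INR (S m) * x) + cos (INR (S m) * y))) s1 /\
    infinite_sum (fun m => b (S m) * (cos (INR (S m) * (x - y)) + cos (INR (S m) * (x + y)))) s2 /\
    f x y = s1 + s2.

(* Q(u,v) in terms of the derivative families U, V of u, v *)
Definition Qop (U V : nat -> nat -> R -> R -> R) (x y : R) : R :=
  U 1%nat 1%nat x y * (V 0%nat 4%nat x y - V 4%nat 0%nat x y)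
  + 3 * (U 0%nat 3%nat x y * V 1%nat 2%nat x y - U 3%nat 0%nat x y * V 2%nat 1%nat x y)
  + 2 * (U 0%nat 2%nat x y * V 1%nat 3%nat x y - U 2%nat 0%nat x y * V 3%nat 1%nat x y).

(* right-hand side of the (k+1)-th equation: sum_{p+q=k} Q(lambda_p, lambda_q) *)
Definition rhs (L : nat -> nat -> nat -> R -> R -> R) (k : nat) (x y : R) : R :=
  sum_f_R0 (fun p => Qop (L p) (L (k - p)%nat) x y) k.

Definition symmetric3 (f : R -> R -> R) : Prop :=
  forall x y, f (- x) y = f x y /\ f x (- y) = f x y /\ f y x = f x y.

(* Main.v *)
(** All symmetries of the [lambda_k] pass to the right-hand side: it is odd in [x], odd in
    [y] and changes sign under [x <-> y].  Hence on every line of direction (1,0), (0,1),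
    (1,1) or (1,-1) it is reversed in sign by a reflection of that line, so its mean on the
    line vanishes; this says that its resonant Fourier coefficients vanish.

    As [d_x d_y (d_x^2 - d_y^2) = d_x d_y (d_x + d_y) (d_x - d_y)], the equation is solved by
    four successive periodic antiderivatives along these directions.  The periodic
    antiderivative along [(a, b)] is the convolution of [f (x + a s) (y + b s)] with the
    sawtooth [(s - PI) / (2 PI)]; it commutes with all derivatives, so it stays inside
    smooth families, and it preserves vanishing line means.

    Uniqueness is completeness of the trigonometric system: integrating by parts, the
    non-resonant coefficients of the difference of two solutions vanish too.  Uniqueness in
    turn gives the symmetry of the solution. *)
Require Import Defs.
From Stdlib Require Import Reals ZArith Lra Lia.
From Coquelicot Require Import Coquelicot.
Open Scope R_scope.

(** * Continuity and Riemann integrals with parameters *)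

(** Dividing Fourier coefficients by [m n (m^2 - n^2)] would call for decay estimates on the
    coefficients of products and for termwise differentiation of double series. Working with line
    means avoids both: only the one-dimensional cosine series of the data are ever summed. Zero line
    means are a pointwise condition, and integrals along different directions commute, so all four
    conditions survive each of the four integrations. Fourier coefficients come back only in the
    uniqueness argument.

    Smoothness is carried by whole derivative families, so each construction (product,
    antiderivative, reflection, series) has to supply all its derivatives at once. In return a
    family is determined by its entry at [(0,0)]: periodicity, parity or a zero line mean checked
    for the function passes to every derivative by comparing two families.

    The integrals of the statement contain integrability proofs; for continuous integrands they are
    traded once and for all for the total integral [RInt]. *)

Lemma cont2_2d (f : R -> R -> R) :
  cont2 f <-> forall x y, continuity_2d_pt f x y.
Proof.
  split; intros H x y.
  - intros eps. destruct (H x y eps (cond_pos eps)) as [d [Hd H']].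
    exists (mkposreal d Hd). exact H'.
  - intros eps Heps. destruct (H x y (mkposreal eps Heps)) as [d H'].
    exists d. split; [apply cond_pos | exact H'].
Qed.

Lemma cont2_const (c : R) : cont2 (fun _ _ => c).
Proof. apply cont2_2d; intros; apply continuity_2d_pt_const. Qed.

Lemma cont2_fst : cont2 (fun x _ => x).
Proof. apply cont2_2d; intros; apply continuity_2d_pt_id1. Qed.

Lemma cont2_snd : cont2 (fun _ y => y).
Proof. apply cont2_2d; intros; apply continuity_2d_pt_id2. Qed.

Lemma cont2_plus (f g : R -> R -> R) :
  cont2 f -> cont2 g -> cont2 (fun x y => f x y + g x y).
Proof.
  intros Hf Hg; apply cont2_2d; intros.
  apply continuity_2d_pt_plus; revert x y; apply cont2_2d; assumption.
Qed.

Lemma cont2_minus (f g : R -> R -> R) :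
  cont2 f -> cont2 g -> cont2 (fun x y => f x y - g x y).
Proof.
  intros Hf Hg; apply cont2_2d; intros.
  apply continuity_2d_pt_minus; revert x y; apply cont2_2d; assumption.
Qed.

Lemma cont2_mult (f g : R -> R -> R) :
  cont2 f -> cont2 g -> cont2 (fun x y => f x y * g x y).
Proof.
  intros Hf Hg; apply cont2_2d; intros.
  apply continuity_2d_pt_mult; revert x y; apply cont2_2d; assumption.
Qed.

Lemma cont2_comp (f g h : R -> R -> R) :
  cont2 f -> cont2 g -> cont2 h -> cont2 (fun x y => f (g x y) (h x y)).
Proof.
  intros Hf Hg Hh x y eps Heps.
  destruct (Hf (g x y) (h x y) eps Heps) as [d [Hd H]].
  destruct (Hg x y d Hd) as [d1 [Hd1 H1]].
  destruct (Hh x y d Hd) as [d2 [Hd2 H2]].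
  exists (Rmin d1 d2). split; [apply Rmin_pos; assumption|].
  intros x' y' Hx Hy.
  pose proof (Rmin_l d1 d2); pose proof (Rmin_r d1 d2).
  apply H; [apply H1 | apply H2]; lra.
Qed.

Lemma cont2_comp1 (f : R -> R) (g : R -> R -> R) :
  (forall t, continuous f t) -> cont2 g -> cont2 (fun x y => f (g x y)).
Proof.
  intros Hf Hg; apply cont2_2d; intros.
  apply continuity_1d_2d_pt_comp.
  - apply continuity_pt_filterlim, Hf.
  - revert x y; apply cont2_2d, Hg.
Qed.

Lemma cont2_ext (f g : R -> R -> R) :
  (forall x y, f x y = g x y) -> cont2 f -> cont2 g.
Proof.
  intros E H x y eps Heps. destruct (H x y eps Heps) as [d [Hd H']].
  exists d; split; [exact Hd|]. intros; rewrite <- !E; auto.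
Qed.

Lemma cont2_cos (g : R -> R -> R) : cont2 g -> cont2 (fun x y => cos (g x y)).
Proof. apply cont2_comp1, continuous_cos. Qed.

Lemma cont2_sin (g : R -> R -> R) : cont2 g -> cont2 (fun x y => sin (g x y)).
Proof. apply cont2_comp1, continuous_sin. Qed.

Lemma cont2_swap (f : R -> R -> R) : cont2 f -> cont2 (fun x y => f y x).
Proof. intros H; apply (cont2_comp f _ _ H cont2_snd cont2_fst). Qed.

Lemma cont2_opp (f : R -> R -> R) : cont2 f -> cont2 (fun x y => - f x y).
Proof.
  intros Hf; apply cont2_2d; intros.
  apply continuity_2d_pt_opp; revert x y; apply cont2_2d, Hf.
Qed.

Ltac cont2_tac :=
  repeat first
    [ assumption | apply cont2_const | apply cont2_fst | apply cont2_snd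
    | match goal with
      | |- cont2 (fun x y => _ + _) => apply cont2_plus
      | |- cont2 (fun x y => _ - _) => apply cont2_minus
      | |- cont2 (fun x y => - _) => apply cont2_opp
      | |- cont2 (fun x y => _ * _) => apply cont2_mult
      | |- cont2 (fun x y => cos _) => apply cont2_cos
      | |- cont2 (fun x y => sin _) => apply cont2_sin
      | H : cont2 ?f |- cont2 (fun x y => ?f _ _) => apply (cont2_comp f); [exact H | |]
      | H : forall t, continuous ?f t |- cont2 (fun x y => ?f _) =>
          apply (cont2_comp1 f); [exact H |]
      end ].

Lemma cont2_slice_r (f : R -> R -> R) (x : R) :
  cont2 f -> forall z, continuous (fun y => f x y) z.
Proof.
  intros H z. apply continuity_pt_filterlim. intros eps Heps.
  destruct (H x z eps Heps) as [d [Hd H']].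
  exists d; split; [exact Hd|]. intros t [_ Ht].
  apply H'; [rewrite Rminus_diag, Rabs_R0; exact Hd | exact Ht].
Qed.

Lemma cont2_slice_l (f : R -> R -> R) (y : R) :
  cont2 f -> forall z, continuous (fun x => f x y) z.
Proof. intros H; apply (cont2_slice_r (fun a b => f b a)), cont2_swap, H. Qed.

Lemma ex_RInt_cont (f : R -> R) (a b : R) :
  (forall z, continuous f z) -> ex_RInt f a b.
Proof. intros H; apply (ex_RInt_continuous (V := R_CompleteNormedModule)); auto. Qed.

Lemma ex_RInt_slice (f : R -> R -> R) (x a b : R) :
  cont2 f -> ex_RInt (fun y => f x y) a b.
Proof. intros H; apply ex_RInt_cont, cont2_slice_r, H. Qed.

Lemma cont_abs_bounded (w : R -> R) (a b : R) :
  a <= b -> (forall t, continuous w t) ->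
  exists B, 0 < B /\ forall t, a <= t <= b -> Rabs (w t) <= B.
Proof.
  intros Hab Hw.
  destruct (continuity_ab_maj (fun t => Rabs (w t)) a b Hab) as [M [HM _]].
  { intros c _. apply continuity_pt_filterlim.
    apply (continuous_comp w Rabs); [apply Hw | apply continuous_Rabs]. }
  exists (Rabs (w M) + 1). split; [pose proof (Rabs_pos (w M)); lra|].
  intros t Ht. specialize (HM t Ht). cbv beta in HM. lra.
Qed.

(** One weighted integral serves three purposes: weight 1 gives line means, the sawtooth weight
    gives antiderivatives, and direction [(0, 1)] gives ordinary integrals with a parameter. *)
Definition line_int (w : R -> R) (a b : R) (f : R -> R -> R) (T x y : R) : R :=
  RInt (fun s => w s * f (x + a * s) (y + b * s)) 0 T.

Lemma cont2_line_int_pos (w : R -> R) (a b : R) (f : R -> R -> R) (T : R) :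
  0 <= T -> (forall s, continuous w s) -> cont2 f ->
  cont2 (line_int w a b f T).
Proof.
  intros HT Hw Hf x y eps Heps.
  destruct (cont_abs_bounded w 0 T HT Hw) as [B [HB Hwb]].
  (* The square of half-side [r] contains the segments issued from [(x, y)] and from any point
     within distance 1 of it. *)
  set (r := 1 + (Rabs a + Rabs b) * T).
  (* [T + 1] instead of [T] avoids division by zero for [T = 0] and makes the final inequality
     strict. *)
  assert (Hpos : 0 < eps / ((T + 1) * B)).
  { apply Rdiv_lt_0_compat; [exact Heps | apply Rmult_lt_0_compat; lra]. }
  destruct (uniform_continuity_2d f (x - r) (x + r) (y - r) (y + r)
    ltac:(intros; apply cont2_2d, Hf) (mkposreal _ Hpos)) as [d Hd].
  exists (Rmin d 1). split; [apply Rmin_pos; [apply cond_pos | lra]|].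
  intros x' y' Hx' Hy'. unfold line_int.
  pose proof (Rmin_l d 1); pose proof (Rmin_r d 1).
  assert (Hc : forall u v, ex_RInt (fun s => w s * f (u + a * s) (v + b * s)) 0 T).
  { intros u v. apply (ex_RInt_slice (fun _ s => w s * f (u + a * s) (v + b * s)) 0).
    cont2_tac. }
  replace (_ - _) with
    (RInt (fun s => w s * (f (x' + a * s) (y' + b * s) - f (x + a * s) (y + b * s))) 0 T).
  2:{ rewrite <- (RInt_minus (V := R_CompleteNormedModule)) by apply Hc.
      apply RInt_ext. intros s _. unfold minus, plus, opp; simpl. ring. }
  apply Rle_lt_trans with ((T - 0) * (B * (eps / ((T + 1) * B)))).
  - apply abs_RInt_le_const; [exact HT | |].
    + apply (ex_RInt_slice (fun _ s =>
        w s * (f (x' + a * s) (y' + b * s) - f (x + a * s) (y + b * s))) 0).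
      cont2_tac.
    + intros t Ht. cbv beta. rewrite Rabs_mult. apply Rmult_le_compat; try apply Rabs_pos.
      * apply Hwb, Ht.
      * assert (Hbd : forall c, Rabs (c * t) <= Rabs c * T).
        { intros c. rewrite Rabs_mult, (Rabs_pos_eq t) by lra.
          apply Rmult_le_compat_l; [apply Rabs_pos | lra]. }
        pose proof (Hbd a) as Ha; pose proof (Hbd b) as Hb.
        assert (0 <= Rabs a * T) by (apply Rmult_le_pos; [apply Rabs_pos | lra]).
        assert (0 <= Rabs b * T) by (apply Rmult_le_pos; [apply Rabs_pos | lra]).
        apply Rabs_le_between in Ha. apply Rabs_le_between in Hb.
        apply Rabs_lt_between in Hx'. apply Rabs_lt_between in Hy'.
        left. apply (Hd (x + a * t) (y + b * t)); unfold r; try lra.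
        -- replace (x' + a * t - (x + a * t)) with (x' - x) by ring.
           apply Rabs_lt_between; lra.
        -- replace (y' + b * t - (y + b * t)) with (y' - y) by ring.
           apply Rabs_lt_between; lra.
  - replace ((T - 0) * (B * (eps / ((T + 1) * B)))) with (eps * (T / (T + 1)))
      by (field; lra).
    rewrite <- (Rmult_1_r eps) at 2. apply Rmult_lt_compat_l; [exact Heps|].
    apply Rmult_lt_reg_r with (T + 1); [lra|].
    replace (T / (T + 1) * (T + 1)) with T by (field; lra). lra.
Qed.

Lemma RInt_reflect (g : R -> R) (a b c : R) :
  (forall z, continuous g z) ->
  RInt (fun s => g (c - s)) a b = RInt g (c - b) (c - a).
Proof.
  intros Hg.
  pose proof (RInt_comp_lin (V := R_CompleteNormedModule) g (-1) c a b
    (ex_RInt_cont _ _ _ Hg)) as H.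
  replace (-1 * a + c) with (c - a) in H by ring.
  replace (-1 * b + c) with (c - b) in H by ring.
  rewrite <- (opp_RInt_swap (V := R_CompleteNormedModule) g (c - a) (c - b)), <- H
    by (apply ex_RInt_cont, Hg).
  rewrite <- (RInt_opp (V := R_CompleteNormedModule)).
  - apply RInt_ext. intros s _. unfold scal, opp; simpl. unfold mult; simpl.
    replace (-1 * s + c) with (c - s) by ring. ring.
  - apply ex_RInt_cont. intros z.
    apply (cont2_slice_r (fun _ s => scal (-1) (g (-1 * s + c))) 0).
    unfold scal; simpl; unfold mult; simpl. cont2_tac.
Qed.

Lemma cont2_line_int (w : R -> R) (a b : R) (f : R -> R -> R) (T : R) :
  (forall s, continuous w s) -> cont2 f -> cont2 (line_int w a b f T).
Proof.
  intros Hw Hf. destruct (Rle_lt_dec 0 T) as [HT | HT].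
  - apply cont2_line_int_pos; assumption.
  - assert (HT' : 0 <= - T) by lra.
    (* Substituting [-s] for [s] reverses the direction and makes the length positive. *)
    apply cont2_ext with
      (fun x y => (-1) * line_int (fun s => w (0 - s)) (- a) (- b) f (- T) x y).
    + intros x y. unfold line_int.
      pose proof (RInt_reflect (fun s => w s * f (x + a * s) (y + b * s)) 0 (- T) 0
        ltac:(apply (cont2_slice_r (fun _ s => w s * f (x + a * s) (y + b * s)) 0);
              cont2_tac)) as H.
      replace (0 - - T) with T in H by ring. replace (0 - 0) with 0 in H by ring.
      rewrite (RInt_ext _ (fun s => w (0 - s) * f (x + a * (0 - s)) (y + b * (0 - s)))).
      2:{ intros s _. f_equal. f_equal; ring. }
      rewrite H, <- (opp_RInt_swap (V := R_CompleteNormedModule) _ 0 T).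
      * unfold opp; simpl; ring.
      * apply (ex_RInt_slice (fun _ s => w s * f (x + a * s) (y + b * s)) 0); cont2_tac.
    + apply cont2_mult; [apply cont2_const|].
      apply cont2_line_int_pos; [exact HT' | | exact Hf].
      apply (cont2_slice_r (fun _ s => w (0 - s)) 0). cont2_tac.
Qed.

Lemma continuous_RInt_param (h : R -> R -> R) (T : R) :
  cont2 h -> forall x, continuous (fun x => RInt (fun y => h x y) 0 T) x.
Proof.
  intros H x.
  apply continuous_ext with (fun u => line_int (fun _ => 1) 0 1 h T u 0).
  - intros u. apply RInt_ext. intros s _. rewrite Rmult_1_l. f_equal; ring.
  - apply (cont2_slice_l (line_int (fun _ => 1) 0 1 h T)).
    apply cont2_line_int; [intros; apply continuous_const | exact H].
Qed.

Lemma is_derive_under_RInt (f f' : R -> R -> R) (a b x : R) :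
  (forall u t, is_derive (fun z => f z t) u (f' u t)) -> cont2 f' ->
  (forall u, ex_RInt (fun t => f u t) a b) ->
  is_derive (fun u => RInt (fun t => f u t) a b) x (RInt (fun t => f' x t) a b).
Proof.
  intros Hd Hc Hi.
  assert (E : forall u t, Derive (fun z => f z t) u = f' u t)
    by (intros; apply is_derive_unique, Hd).
  rewrite <- (RInt_ext (fun t => Derive (fun z => f z t) x)) by (intros; apply E).
  apply is_derive_RInt_param.
  - exists (mkposreal 1 Rlt_0_1). intros; eexists; apply Hd.
  - intros t _. apply continuity_2d_pt_ext with f'.
    + intros; symmetry; apply E.
    + apply cont2_2d, Hc.
  - exists (mkposreal 1 Rlt_0_1). intros; apply Hi.
Qed.

Lemma is_derive_RInt_upper (f : R -> R) (a u : R) :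
  (forall z, continuous f z) -> is_derive (fun u => RInt f a u) u (f u).
Proof.
  intros H. apply (is_derive_RInt (V := R_CompleteNormedModule)) with a.
  - exists (mkposreal 1 Rlt_0_1). intros v _.
    apply (RInt_correct (V := R_CompleteNormedModule)), ex_RInt_cont, H.
  - apply H.
Qed.

(** As functions of the upper limit [u] in [x], both iterated integrals vanish at 0 and have
    derivative [RInt (fun y => h u y) 0 T]; hence they agree at [S]. *)
Lemma RInt_Fubini (h : R -> R -> R) (S T : R) :
  0 < S -> cont2 h ->
  RInt (fun x => RInt (fun y => h x y) 0 T) 0 S =
  RInt (fun y => RInt (fun x => h x y) 0 S) 0 T.
Proof.
  intros HS H.
  assert (Hs := cont2_swap _ H).
  pose (A := fun u => RInt (fun x => RInt (fun y => h x y) 0 T) 0 u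
                      - RInt (fun y => RInt (fun x => h x y) 0 u) 0 T).
  assert (E : A 0 = A S).
  { apply (eq_is_derive (V := R_NormedModule)); [|exact HS]. intros t _.
    (* The derivative 0 is presented as the difference of two equal terms, one for each iterated
       integral. *)
    refine (eq_ind _ (is_derive A t) _ _ (Rminus_diag (RInt (fun y => h t y) 0 T))).
    apply (is_derive_minus (V := R_NormedModule)).
    - apply (is_derive_RInt_upper (fun x => RInt (fun y => h x y) 0 T)).
      apply continuous_RInt_param, H.
    - apply (is_derive_under_RInt (fun u y => RInt (fun x => h x y) 0 u) h).
      + intros u y. apply (is_derive_RInt_upper (fun x => h x y)).
        apply cont2_slice_l, H.
      + exact H.
      + intros u. apply ex_RInt_cont.
        apply (continuous_RInt_param (fun y x => h x y)), Hs. }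
  unfold A in E. rewrite RInt_point in E.
  rewrite (RInt_ext (fun y => RInt (fun x => h x y) 0 0) (fun _ => 0)) in E.
  2:{ intros; apply (RInt_point (V := R_CompleteNormedModule)). }
  rewrite RInt_const in E. unfold scal, zero in E; simpl in E; unfold mult in E; simpl in E.
  lra.
Qed.

Lemma RInt_extR (f g : R -> R) (a b : R) :
  (forall x, f x = g x) -> RInt f a b = RInt g a b.
Proof. intros H; apply RInt_ext; intros; apply H. Qed.

(* [RInt] lives in the carrier of a normed module, where [ring] does not
   recognise the equality of [R]. *)
Ltac to_R := match goal with |- ?l = ?r => change (@eq R l r) end.

(** * Smooth families *)

Lemma RInt_mult_l (c : R) (f : R -> R) (a b : R) :
  (forall z, continuous f z) -> RInt (fun x => c * f x) a b = c * RInt f a b.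
Proof.
  intros H. apply (RInt_scal (V := R_CompleteNormedModule)), ex_RInt_cont, H.
Qed.

Lemma RInt_add (f g : R -> R) (a b : R) :
  (forall z, continuous f z) -> (forall z, continuous g z) ->
  RInt (fun x => f x + g x) a b = RInt f a b + RInt g a b.
Proof.
  intros Hf Hg.
  apply (RInt_plus (V := R_CompleteNormedModule)); apply ex_RInt_cont; assumption.
Qed.

Lemma RInt_zero (f : R -> R) (a b : R) : (forall x, f x = 0) -> RInt f a b = 0.
Proof.
  intros H. rewrite (RInt_ext f (fun _ => 0)) by (intros; apply H).
  rewrite RInt_const. unfold scal; simpl; unfold mult; simpl. ring.
Qed.

(** Translations of the plane commute, and Fubini exchanges the two parameters. This is what lets an
    antiderivative along one direction keep zero means along another. *)
Lemma line_int_comm (w w' : R -> R) (a b c d : R) (f : R -> R -> R) (T x y : R) :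
  0 < T -> (forall s, continuous w s) -> (forall s, continuous w' s) -> cont2 f ->
  line_int w a b (line_int w' c d f T) T x y =
  line_int w' c d (line_int w a b f T) T x y.
Proof.
  intros HT Hw Hw' Hf. unfold line_int.
  transitivity (RInt (fun s => RInt (fun t =>
    w s * (w' t * f (x + a * s + c * t) (y + b * s + d * t))) 0 T) 0 T).
  - apply RInt_extR; intros s. symmetry. apply RInt_mult_l.
    apply (cont2_slice_r (fun _ t => w' t * f (x + a * s + c * t) (y + b * s + d * t)) 0).
    cont2_tac.
  - rewrite RInt_Fubini; [| exact HT | cont2_tac].
    apply RInt_extR; intros t.
    rewrite <- RInt_mult_l.
    + apply RInt_extR; intros s.
      replace (x + c * t + a * s) with (x + a * s + c * t) by ring.
      replace (y + d * t + b * s) with (y + b * s + d * t) by ring. ring.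
    + apply (cont2_slice_r (fun _ s => w s * f (x + c * t + a * s) (y + d * t + b * s)) 0).
      cont2_tac.
Qed.

Lemma smooth_dx (F : nat -> nat -> R -> R -> R) (i j : nat) (x y : R) :
  smooth_family F -> is_derive (fun t => F i j t y) x (F (S i) j x y).
Proof. intros H. apply is_derive_Reals, (H i j). Qed.

Lemma smooth_dy (F : nat -> nat -> R -> R -> R) (i j : nat) (x y : R) :
  smooth_family F -> is_derive (fun t => F i j x t) y (F i (S j) x y).
Proof. intros H. apply is_derive_Reals, (H i j). Qed.

Lemma smooth_cont2 (F : nat -> nat -> R -> R -> R) (i j : nat) :
  smooth_family F -> cont2 (F i j).
Proof. intros H. apply (H i j). Qed.

Lemma smooth_family_intro (F : nat -> nat -> R -> R -> R) :
  (forall i j x y, is_derive (fun t => F i j t y) x (F (S i) j x y)) ->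
  (forall i j x y, is_derive (fun t => F i j x t) y (F i (S j) x y)) ->
  (forall i j, cont2 (F i j)) -> smooth_family F.
Proof.
  intros Hx Hy Hc i j. repeat split.
  - intros; apply is_derive_Reals, Hx.
  - intros; apply is_derive_Reals, Hy.
  - apply Hc.
Qed.

(** Entry [(i, j)] is reached from [(0, 0)] by [j] derivatives in [y] and then [i] in [x], and
    derivatives are unique. It serves to transfer an identity between functions to all their
    derivatives. *)
Lemma smooth_family_unique (F G : nat -> nat -> R -> R -> R) :
  smooth_family F -> smooth_family G ->
  (forall x y, F 0%nat 0%nat x y = G 0%nat 0%nat x y) ->
  forall i j x y, F i j x y = G i j x y.
Proof.
  intros HF HG H0.
  assert (Hj : forall j x y, F 0%nat j x y = G 0%nat j x y).
  { induction j as [|j IH]; [exact H0|]. intros x y.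
    rewrite <- (is_derive_unique _ _ _ (smooth_dy F 0 j x y HF)).
    rewrite <- (is_derive_unique _ _ _ (smooth_dy G 0 j x y HG)).
    apply Derive_ext. intros; apply IH. }
  induction i as [|i IH]; [exact Hj|]. intros j x y.
  rewrite <- (is_derive_unique _ _ _ (smooth_dx F i j x y HF)).
  rewrite <- (is_derive_unique _ _ _ (smooth_dx G i j x y HG)).
  apply Derive_ext. intros; apply IH.
Qed.

Lemma smooth_zero : smooth_family (fun _ _ _ _ => 0).
Proof.
  apply smooth_family_intro; intros; try apply cont2_const;
    apply (is_derive_const (V := R_NormedModule)).
Qed.

Lemma smooth_add (F G : nat -> nat -> R -> R -> R) :
  smooth_family F -> smooth_family G ->
  smooth_family (fun i j x y => F i j x y + G i j x y).
Proof.
  intros HF HG. apply smooth_family_intro; intros.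
  - apply (is_derive_plus (V := R_NormedModule)); apply smooth_dx; assumption.
  - apply (is_derive_plus (V := R_NormedModule)); apply smooth_dy; assumption.
  - apply cont2_plus; apply smooth_cont2; assumption.
Qed.

Lemma smooth_scal (c : R) (F : nat -> nat -> R -> R -> R) :
  smooth_family F -> smooth_family (fun i j x y => c * F i j x y).
Proof.
  intros HF. apply smooth_family_intro; intros.
  - apply is_derive_scal, smooth_dx, HF.
  - apply is_derive_scal, smooth_dy, HF.
  - apply cont2_mult; [apply cont2_const | apply smooth_cont2, HF].
Qed.

Lemma smooth_sub (F G : nat -> nat -> R -> R -> R) :
  smooth_family F -> smooth_family G ->
  smooth_family (fun i j x y => F i j x y - G i j x y).
Proof.
  intros HF HG. apply smooth_family_intro; intros.
  - apply (is_derive_minus (V := R_NormedModule)); apply smooth_dx; assumption.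
  - apply (is_derive_minus (V := R_NormedModule)); apply smooth_dy; assumption.
  - apply cont2_minus; apply smooth_cont2; assumption.
Qed.

(** The family of the derivative [d_x^a d_y^b]. The offsets stand on the left of the sums so that
    numerals compute and such shifts commute by conversion. *)
Definition shift_fam (a b : nat) (F : nat -> nat -> R -> R -> R) :=
  fun i j : nat => F (a + i)%nat (b + j)%nat.

Lemma smooth_shift (a b : nat) (F : nat -> nat -> R -> R -> R) :
  smooth_family F -> smooth_family (shift_fam a b F).
Proof.
  intros HF i j. unfold shift_fam. rewrite !Nat.add_succ_r.
  exact (HF (a + i)%nat (b + j)%nat).
Qed.

Lemma smooth_sum (F : nat -> nat -> nat -> R -> R -> R) (n : nat) :
  (forall p, (p <= n)%nat -> smooth_family (F p)) ->
  smooth_family (fun i j x y => sum_f_R0 (fun p => F p i j x y) n).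
Proof.
  induction n as [|n IH]; intros H; simpl.
  - exact (H 0%nat (Nat.le_refl _)).
  - apply smooth_add; [apply IH; intros; apply H; lia | apply H; lia].
Qed.

(** The Leibniz rule unfolded without binomial coefficients: each derivative splits a product into
    two. The [x]-derivatives are distributed by [prod_fam], which ends here. *)
Fixpoint prod_fam_y (j : nat) (U V : nat -> nat -> R -> R -> R) (x y : R) : R :=
  match j with
  | O => U 0%nat 0%nat x y * V 0%nat 0%nat x y
  | S j => prod_fam_y j (shift_fam 0 1 U) V x y + prod_fam_y j U (shift_fam 0 1 V) x y
  end.

Fixpoint prod_fam (U V : nat -> nat -> R -> R -> R) (i j : nat) (x y : R) : R :=
  match i with
  | O => prod_fam_y j U V x y
  | S i => prod_fam (shift_fam 1 0 U) V i j x y + prod_fam U (shift_fam 1 0 V) i j x y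
  end.

Lemma is_derive_mult_R (f g : R -> R) (x f' g' : R) :
  is_derive f x f' -> is_derive g x g' ->
  is_derive (fun t => f t * g t) x (f' * g x + f x * g').
Proof.
  intros Hf Hg. apply is_derive_Reals.
  apply (derivable_pt_lim_mult f g); apply is_derive_Reals; assumption.
Qed.

Lemma smooth_prod (U V : nat -> nat -> R -> R -> R) :
  smooth_family U -> smooth_family V -> smooth_family (prod_fam U V).
Proof.
  intros HU HV. apply smooth_family_intro.
  - intros i; revert U V HU HV; induction i as [|i IH]; intros U V HU HV.
    + intros j; simpl; revert U V HU HV; induction j as [|j IHj]; intros U V HU HV x y; simpl.
      * apply (is_derive_mult_R (fun t => U 0%nat 0%nat t y) (fun t => V 0%nat 0%nat t y));
          [apply (smooth_dx U 0 0 x y HU) | apply (smooth_dx V 0 0 x y HV)].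
      * assert (HU' := smooth_shift 0 1 U HU). assert (HV' := smooth_shift 0 1 V HV).
        pose proof (is_derive_plus (V := R_NormedModule) _ _ _ _ _
          (IHj _ _ HU' HV x y) (IHj _ _ HU HV' x y)) as H.
        refine (eq_ind _ (is_derive _ x) H _ _). unfold plus; simpl.
        (* Mixed shifts agree by computation; the four terms of the second-order Leibniz rule then
           differ only in their order. *)
        change (shift_fam 0 1 (shift_fam 1 0 U)) with (shift_fam 1 0 (shift_fam 0 1 U)).
        change (shift_fam 0 1 (shift_fam 1 0 V)) with (shift_fam 1 0 (shift_fam 0 1 V)).
        ring.
    + intros j x y. simpl.
      apply (is_derive_plus (V := R_NormedModule)).
      * apply (IH (shift_fam 1 0 U) V (smooth_shift 1 0 U HU) HV).
      * apply (IH U (shift_fam 1 0 V) HU (smooth_shift 1 0 V HV)).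
  - intros i; revert U V HU HV; induction i as [|i IH]; intros U V HU HV.
    + intros j; simpl; revert U V HU HV; induction j as [|j IHj]; intros U V HU HV x y; simpl.
      * apply (is_derive_mult_R (fun t => U 0%nat 0%nat x t) (fun t => V 0%nat 0%nat x t));
          [apply (smooth_dy U 0 0 x y HU) | apply (smooth_dy V 0 0 x y HV)].
      * apply (is_derive_plus (V := R_NormedModule)).
        -- apply (IHj (shift_fam 0 1 U) V (smooth_shift 0 1 U HU) HV).
        -- apply (IHj U (shift_fam 0 1 V) HU (smooth_shift 0 1 V HV)).
    + intros j x y. simpl.
      apply (is_derive_plus (V := R_NormedModule)).
      * apply (IH (shift_fam 1 0 U) V (smooth_shift 1 0 U HU) HV).
      * apply (IH U (shift_fam 1 0 V) HU (smooth_shift 1 0 V HV)).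
  - intros i; revert U V HU HV; induction i as [|i IH]; intros U V HU HV.
    + intros j; simpl; revert U V HU HV; induction j as [|j IHj]; intros U V HU HV; simpl.
      * apply cont2_mult; apply smooth_cont2; assumption.
      * apply cont2_plus; apply IHj; try apply smooth_shift; assumption.
    + intros j; simpl. apply cont2_plus; apply IH; try apply smooth_shift; assumption.
Qed.

(** The chain rule needs total differentiability, which follows from both partial derivatives once
    the one in [x] is continuous. *)
Lemma is_derive_line (F : nat -> nat -> R -> R -> R) (i j : nat) (a b x y s : R) :
  smooth_family F ->
  is_derive (fun t => F i j (x + a * t) (y + b * t)) s
    (a * F (S i) j (x + a * s) (y + b * s) + b * F i (S j) (x + a * s) (y + b * s)).
Proof.
  intros HF. apply is_derive_Reals.
  replace (a * _ + b * _) with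
    (F (S i) j (x + a * s) (y + b * s) * a + F i (S j) (x + a * s) (y + b * s) * b) by ring.
  assert (Hl : forall c d, derivable_pt_lim (fun t => c + d * t) s d).
  { intros c d. apply is_derive_Reals. auto_derive; [exact I | ring]. }
  apply (derivable_pt_lim_comp_2d (F i j) (fun t => x + a * t) (fun t => y + b * t));
    [| apply Hl | apply Hl].
  apply filterdiff_differentiable_pt_lim.
  apply (is_derive_filterdiff (F i j) _ _ (F (S i) j)).
  - exists (mkposreal 1 Rlt_0_1). intros [u v] _. apply smooth_dx, HF.
  - apply smooth_dy, HF.
  - apply continuity_2d_pt_filterlim. apply cont2_2d, smooth_cont2, HF.
Qed.

Lemma smooth_line_int (w : R -> R) (a b T : R) (F : nat -> nat -> R -> R -> R) :
  (forall s, continuous w s) -> smooth_family F ->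
  smooth_family (fun i j => line_int w a b (F i j) T).
Proof.
  intros Hw HF.
  assert (HC : forall i j, cont2 (F i j)) by (intros; apply smooth_cont2, HF).
  apply smooth_family_intro.
  - intros i j x y. unfold line_int. pose proof (HC (S i) j). pose proof (HC i j).
    apply (is_derive_under_RInt (fun u s => w s * F i j (u + a * s) (y + b * s))
      (fun u s => w s * F (S i) j (u + a * s) (y + b * s))).
    + intros u s. apply is_derive_scal.
      pose proof (is_derive_comp (fun z => F i j z (y + b * s)) (fun z => z + a * s) u
        (F (S i) j (u + a * s) (y + b * s)) 1
        (smooth_dx F i j _ _ HF) ltac:(auto_derive; [exact I | ring])) as H1.
      exact (eq_ind _ (is_derive _ u) H1 _ (Rmult_1_l _)).
    + cont2_tac.
    + intros u. apply (ex_RInt_slice (fun _ s => w s * F i j (u + a * s) (y + b * s)) 0).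
      cont2_tac.
  - intros i j x y. unfold line_int. pose proof (HC i (S j)). pose proof (HC i j).
    apply (is_derive_under_RInt (fun v s => w s * F i j (x + a * s) (v + b * s))
      (fun v s => w s * F i (S j) (x + a * s) (v + b * s))).
    + intros v s. apply is_derive_scal.
      pose proof (is_derive_comp (fun z => F i j (x + a * s) z) (fun z => z + b * s) v
        (F i (S j) (x + a * s) (v + b * s)) 1
        (smooth_dy F i j _ _ HF) ltac:(auto_derive; [exact I | ring])) as H1.
      exact (eq_ind _ (is_derive _ v) H1 _ (Rmult_1_l _)).
    + cont2_tac.
    + intros v. apply (ex_RInt_slice (fun _ s => w s * F i j (x + a * s) (v + b * s)) 0).
      cont2_tac.
  - intros i j. apply cont2_line_int; [exact Hw | apply HC].
Qed.

(** * Antiderivatives along lines *)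

(** Used with [p], [q] equal to 1 or -1: translations by [2 * PI] yield periodicity of the
    derivatives, reflections yield their parity. *)
Lemma smooth_affine (p q c d : R) (F : nat -> nat -> R -> R -> R) :
  smooth_family F ->
  smooth_family (fun i j x y => p ^ i * q ^ j * F i j (p * x + c) (q * y + d)).
Proof.
  intros HF. apply smooth_family_intro.
  - intros i j x y.
    pose proof (is_derive_comp (fun z => F i j z (q * y + d)) (fun z => p * z + c) x
      (F (S i) j (p * x + c) (q * y + d)) p
      (smooth_dx F i j _ _ HF) ltac:(auto_derive; [exact I | ring])) as H.
    apply (is_derive_scal _ _ (p ^ i * q ^ j)) in H.
    refine (eq_ind _ (is_derive _ x) H _ _).
    unfold scal; simpl; unfold mult; simpl. ring.
  - intros i j x y.
    pose proof (is_derive_comp (fun z => F i j (p * x + c) z) (fun z => q * z + d) y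
      (F i (S j) (p * x + c) (q * y + d)) q
      (smooth_dy F i j _ _ HF) ltac:(auto_derive; [exact I | ring])) as H.
    apply (is_derive_scal _ _ (p ^ i * q ^ j)) in H.
    refine (eq_ind _ (is_derive _ y) H _ _).
    unfold scal; simpl; unfold mult; simpl. ring.
  - intros i j. pose proof (smooth_cont2 F i j HF). cont2_tac.
Qed.

Lemma smooth_swap (F : nat -> nat -> R -> R -> R) :
  smooth_family F -> smooth_family (fun i j x y => F j i y x).
Proof.
  intros HF. apply smooth_family_intro; intros.
  - apply (smooth_dy F j i y x HF).
  - apply (smooth_dx F j i y x HF).
  - apply cont2_swap, smooth_cont2, HF.
Qed.

Lemma smooth_periodic (F : nat -> nat -> R -> R -> R) :
  smooth_family F -> periodic2 (F 0%nat 0%nat) -> forall i j, periodic2 (F i j).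
Proof.
  intros HF HP i j x y. split.
  - transitivity (1 ^ i * 1 ^ j * F i j (1 * x + 2 * PI) (1 * y + 0)).
    { rewrite !pow1, !Rmult_1_l, Rplus_0_r. reflexivity. }
    apply (smooth_family_unique _ F (smooth_affine 1 1 (2 * PI) 0 F HF) HF).
    intros u v. simpl. rewrite !Rmult_1_l, Rplus_0_r. apply HP.
  - transitivity (1 ^ i * 1 ^ j * F i j (1 * x + 0) (1 * y + 2 * PI)).
    { rewrite !pow1, !Rmult_1_l, Rplus_0_r. reflexivity. }
    apply (smooth_family_unique _ F (smooth_affine 1 1 0 (2 * PI) F HF) HF).
    intros u v. simpl. rewrite !Rmult_1_l, Rplus_0_r. apply HP.
Qed.

(** For the integer directions in use, the parameter interval [[0, 2 * PI]] closes up on the torus,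
    so this is the mean over a closed curve up to a factor. *)
Definition line_mean_zero (a b : R) (f : R -> R -> R) : Prop :=
  forall x y, line_int (fun _ => 1) a b f (2 * PI) x y = 0.

Lemma continuous_one (s : R) : continuous (fun _ : R => 1) s.
Proof. apply continuous_const. Qed.

Lemma two_PI_pos : 0 < 2 * PI.
Proof. pose proof PI_RGT_0; lra. Qed.

Lemma line_mean_zero_family (a b : R) (F : nat -> nat -> R -> R -> R) :
  smooth_family F -> line_mean_zero a b (F 0%nat 0%nat) ->
  forall i j, line_mean_zero a b (F i j).
Proof.
  intros HF H i j x y.
  apply (smooth_family_unique _ _ (smooth_line_int _ a b (2 * PI) F continuous_one HF)
    smooth_zero H).
Qed.

Lemma line_mean_zero_line_int (w : R -> R) (a b c d : R) (f : R -> R -> R) :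
  (forall s, continuous w s) -> cont2 f -> line_mean_zero c d f ->
  line_mean_zero c d (line_int w a b f (2 * PI)).
Proof.
  intros Hw Hf H x y.
  rewrite line_int_comm; [| apply two_PI_pos | apply continuous_one | exact Hw | exact Hf].
  apply RInt_zero. intros s. rewrite H. ring.
Qed.

(* Convolution along a line with the sawtooth [(s - PI) / (2 PI)] is the
   periodic antiderivative of functions with zero mean on these lines. *)
Definition sawtooth (s : R) : R := (s - PI) / (2 * PI).

Lemma continuous_sawtooth (s : R) : continuous sawtooth s.
Proof.
  apply (cont2_slice_r (fun _ s => sawtooth s) 0). unfold sawtooth, Rdiv. cont2_tac.
Qed.

Definition antider (a b : R) (F : nat -> nat -> R -> R -> R) : nat -> nat -> R -> R -> R :=
  fun i j => line_int sawtooth a b (F i j) (2 * PI).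

(** Integration by parts along the line. The sawtooth has slope [1 / (2 PI)], so the integral left
    over is a multiple of the line mean and vanishes; its values -1/2 and 1/2 at the ends turn the
    boundary term into [F i j x y]. *)
Lemma antider_transport (a b : R) (F : nat -> nat -> R -> R -> R) (i j : nat) (x y : R) :
  smooth_family F ->
  F i j (x + a * (2 * PI)) (y + b * (2 * PI)) = F i j x y ->
  line_mean_zero a b (F i j) ->
  a * antider a b F (S i) j x y + b * antider a b F i (S j) x y = F i j x y.
Proof.
  intros HF HP H0. unfold antider, line_int.
  pose proof (smooth_cont2 F i j HF). pose proof (smooth_cont2 F (S i) j HF).
  pose proof (smooth_cont2 F i (S j) HF). pose proof continuous_sawtooth as Hsaw.
  pose proof PI_RGT_0 as Hpi.
  set (f := fun s => F i j (x + a * s) (y + b * s)).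
  set (fx := fun s => sawtooth s * F (S i) j (x + a * s) (y + b * s)).
  set (fy := fun s => sawtooth s * F i (S j) (x + a * s) (y + b * s)).
  assert (Cf : forall s, continuous f s).
  { unfold f. apply (cont2_slice_r (fun _ s => F i j (x + a * s) (y + b * s)) 0). cont2_tac. }
  assert (Cx : forall s, continuous fx s).
  { unfold fx.
    apply (cont2_slice_r (fun _ s => sawtooth s * F (S i) j (x + a * s) (y + b * s)) 0).
    cont2_tac. }
  assert (Cy : forall s, continuous fy s).
  { unfold fy.
    apply (cont2_slice_r (fun _ s => sawtooth s * F i (S j) (x + a * s) (y + b * s)) 0).
    cont2_tac. }
  (* The derivative of [sawtooth s * f s]. *)
  set (df := fun s => / (2 * PI) * f s + (a * fx s + b * fy s)).
  assert (Cdf : forall s, continuous df s).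
  { apply (cont2_slice_r (fun _ s => df s) 0). unfold df. cont2_tac. }
  assert (Hd : is_RInt df 0 (2 * PI)
    (sawtooth (2 * PI) * f (2 * PI) - sawtooth 0 * f 0)).
  { apply (is_RInt_derive (V := R_CompleteNormedModule) (fun s => sawtooth s * f s) df).
    - intros s _.
      assert (Hs : is_derive sawtooth s (/ (2 * PI))).
      { unfold sawtooth. auto_derive; [exact I | field; lra]. }
      pose proof (is_derive_mult_R _ _ _ _ _ Hs (is_derive_line F i j a b x y s HF)) as Hm.
      refine (eq_ind _ (is_derive _ s) Hm _ _). unfold df, fx, fy, f.
      to_R. ring.
    - intros; apply Cdf. }
  apply (is_RInt_unique (V := R_CompleteNormedModule)) in Hd. unfold df in Hd.
  rewrite RInt_add in Hd.
  2:{ apply (cont2_slice_r (fun _ s => / (2 * PI) * f s) 0). cont2_tac. }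
  2:{ apply (cont2_slice_r (fun _ s => a * fx s + b * fy s) 0). cont2_tac. }
  rewrite RInt_add in Hd.
  2:{ apply (cont2_slice_r (fun _ s => a * fx s) 0). cont2_tac. }
  2:{ apply (cont2_slice_r (fun _ s => b * fy s) 0). cont2_tac. }
  rewrite !RInt_mult_l in Hd by assumption.
  assert (E0 : RInt f 0 (2 * PI) = 0).
  { refine (eq_trans _ (H0 x y)). apply RInt_extR. intros s. unfold f. ring. }
  rewrite E0 in Hd. unfold f in Hd. rewrite HP, !Rmult_0_r, !Rplus_0_r, Rplus_0_l in Hd.
  rewrite Hd. unfold sawtooth. field. lra.
Qed.

(* The four directions are the characteristics of [d_x d_y (d_x^2 - d_y^2)]. *)
Definition solvable_family (F : nat -> nat -> R -> R -> R) : Prop :=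
  smooth_family F /\ (forall i j, periodic2 (F i j)) /\
  forall i j, line_mean_zero 1 0 (F i j) /\ line_mean_zero 0 1 (F i j) /\
              line_mean_zero 1 1 (F i j) /\ line_mean_zero 1 (-1) (F i j).

Lemma solvable_antider (a b : R) (F : nat -> nat -> R -> R -> R) :
  solvable_family F -> solvable_family (antider a b F).
Proof.
  intros [HF [HP H0]]. split; [|split].
  - apply smooth_line_int; [apply continuous_sawtooth | exact HF].
  - intros i j x y. unfold antider, line_int.
    split; apply RInt_extR; intros s; f_equal.
    + replace (x + 2 * PI + a * s) with (x + a * s + 2 * PI) by ring. apply HP.
    + replace (y + 2 * PI + b * s) with (y + b * s + 2 * PI) by ring. apply HP.
  - intros i j. destruct (H0 i j) as [H1 [H2 [H3 H4]]].
    repeat split; apply line_mean_zero_line_int; try assumption;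
      solve [apply continuous_sawtooth | apply smooth_cont2, HF].
Qed.

Definition solution (F : nat -> nat -> R -> R -> R) : nat -> nat -> R -> R -> R :=
  antider 1 0 (antider 0 1 (antider 1 1 (antider 1 (-1) F))).

Lemma solvable_solution (F : nat -> nat -> R -> R -> R) :
  solvable_family F -> solvable_family (solution F).
Proof. intros H; unfold solution; do 4 apply solvable_antider; exact H. Qed.

Lemma antider_dx (F : nat -> nat -> R -> R -> R) (i j : nat) (x y : R) :
  solvable_family F -> antider 1 0 F (S i) j x y = F i j x y.
Proof.
  intros [HS [HP Hm]].
  pose proof (antider_transport 1 0 F i j x y HS) as E.
  rewrite !Rmult_1_l, !Rmult_0_l, !Rplus_0_r in E.
  apply E; [| exact (proj1 (Hm i j))].
  apply HP.
Qed.

Lemma antider_dy (F : nat -> nat -> R -> R -> R) (i j : nat) (x y : R) :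
  solvable_family F -> antider 0 1 F i (S j) x y = F i j x y.
Proof.
  intros [HS [HP Hm]].
  pose proof (antider_transport 0 1 F i j x y HS) as E.
  rewrite !Rmult_1_l, !Rmult_0_l, !Rplus_0_l, Rplus_0_r in E.
  apply E; [| exact (proj1 (proj2 (Hm i j)))].
  apply HP.
Qed.

Lemma antider_diag (F : nat -> nat -> R -> R -> R) (i j : nat) (x y : R) :
  solvable_family F -> antider 1 1 F (S i) j x y + antider 1 1 F i (S j) x y = F i j x y.
Proof.
  intros [HS [HP Hm]].
  pose proof (antider_transport 1 1 F i j x y HS) as E.
  rewrite !Rmult_1_l in E.
  apply E; [| exact (proj1 (proj2 (proj2 (Hm i j))))].
  rewrite (proj2 (HP _ _ _ _)). apply HP.
Qed.

Lemma antider_antidiag (F : nat -> nat -> R -> R -> R) (i j : nat) (x y : R) :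
  solvable_family F ->
  antider 1 (-1) F (S i) j x y - antider 1 (-1) F i (S j) x y = F i j x y.
Proof.
  intros [HS [HP Hm]].
  pose proof (antider_transport 1 (-1) F i j x y HS) as E.
  change (-1) with (- (1)) in E. rewrite <- !Ropp_mult_distr_l, !Rmult_1_l in E.
  apply E; [| exact (proj2 (proj2 (proj2 (Hm i j))))].
  rewrite (proj1 (HP _ _ _ _)).
  rewrite <- (proj2 (HP i j x (y + - (2 * PI)))). f_equal. ring.
Qed.

(** The two outer antiderivatives cancel [d_x d_y] and leave the entries [(2,0)] and [(0,2)] of the
    next one. The diagonal identity at [(1,0)] minus the one at [(0,1)] eliminates the entry [(1,1)]
    and leaves exactly the antidiagonal identity. *)
Lemma solution_eq (F : nat -> nat -> R -> R -> R) (x y : R) :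
  solvable_family F ->
  solution F 3%nat 1%nat x y - solution F 1%nat 3%nat x y = F 0%nat 0%nat x y.
Proof.
  intros H0. assert (H1 := solvable_antider 1 (-1) F H0).
  assert (H2 := solvable_antider 1 1 _ H1). assert (H3 := solvable_antider 0 1 _ H2).
  unfold solution.
  rewrite (antider_dx _ 2 1 x y H3), (antider_dx _ 0 3 x y H3).
  rewrite (antider_dy _ 2 0 x y H2), (antider_dy _ 0 2 x y H2).
  pose proof (antider_diag _ 1 0 x y H1). pose proof (antider_diag _ 0 1 x y H1).
  pose proof (antider_antidiag _ 0 0 x y H0).
  repeat match goal with |- context [antider ?a ?b ?G ?i ?j ?u ?v] =>
    generalize dependent (antider a b G i j u v) end. intros; lra.
Qed.

(** * Fourier coefficients and line means *)

Definition torus_int (h : R -> R -> R) : R :=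
  RInt (fun x => RInt (fun y => h x y) 0 (2 * PI)) 0 (2 * PI).

Lemma is_integral_RInt (g : R -> R) (a b v : R) :
  is_integral g a b v -> RInt g a b = v.
Proof. intros [pr H]. rewrite <- H. apply RInt_Reals. Qed.

Lemma RInt_is_integral (g : R -> R) (a b : R) :
  (forall z, continuous g z) -> is_integral g a b (RInt g a b).
Proof.
  intros H. exists (ex_RInt_Reals_0 _ _ _ (ex_RInt_cont g a b H)).
  symmetry. apply RInt_Reals.
Qed.

(** Continuity makes every slice, and the inner integral as a function of [x], integrable; this
    allows all later computations with Fourier coefficients to use [torus_int]. *)
Lemma is_integral2_torus_int (h : R -> R -> R) (v : R) :
  cont2 h -> is_integral2 h v <-> torus_int h = v.
Proof.
  intros Hh. split.
  - intros [g [Hg Hv]]. apply is_integral_RInt in Hv. rewrite <- Hv.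
    apply RInt_extR. intros x. apply is_integral_RInt, Hg.
  - intros <-. exists (fun x => RInt (fun y => h x y) 0 (2 * PI)). split.
    + intros x. apply RInt_is_integral, cont2_slice_r, Hh.
    + apply RInt_is_integral, continuous_RInt_param, Hh.
Qed.

Lemma torus_int_ext (f g : R -> R -> R) :
  (forall x y, f x y = g x y) -> torus_int f = torus_int g.
Proof. intros H. apply RInt_extR; intros x. apply RInt_extR; intros y. apply H. Qed.

Lemma torus_int_add (f g : R -> R -> R) :
  cont2 f -> cont2 g ->
  torus_int (fun x y => f x y + g x y) = torus_int f + torus_int g.
Proof.
  intros Hf Hg. unfold torus_int.
  rewrite <- RInt_add by (apply continuous_RInt_param; assumption).
  apply RInt_extR; intros x. apply RInt_add; apply cont2_slice_r; assumption.
Qed.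

Lemma torus_int_mult_l (c : R) (f : R -> R -> R) :
  cont2 f -> torus_int (fun x y => c * f x y) = c * torus_int f.
Proof.
  intros Hf. unfold torus_int.
  rewrite <- RInt_mult_l by (apply continuous_RInt_param; assumption).
  apply RInt_extR; intros x. apply RInt_mult_l, cont2_slice_r, Hf.
Qed.

Lemma RInt_translate (g : R -> R) (c a b : R) :
  (forall z, continuous g z) -> RInt (fun s => g (s + c)) a b = RInt g (a + c) (b + c).
Proof.
  intros Hg.
  pose proof (RInt_comp_lin (V := R_CompleteNormedModule) g 1 c a b
    (ex_RInt_cont _ _ _ Hg)) as H.
  rewrite !Rmult_1_l in H. rewrite <- H. apply RInt_extR. intros s.
  unfold scal; simpl; unfold mult; simpl. rewrite !Rmult_1_l. reflexivity.
Qed.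

Lemma RInt_Chasles_R (g : R -> R) (a b c : R) :
  (forall z, continuous g z) -> RInt g a b + RInt g b c = RInt g a c.
Proof.
  intros Hg. apply (RInt_Chasles (V := R_CompleteNormedModule)); apply ex_RInt_cont, Hg.
Qed.

(** The pieces [[0, c]] and [[2 PI, c + 2 PI]] have equal integrals; as integrals are oriented, the
    sign of [c] does not matter. *)
Lemma RInt_period_shift (g : R -> R) (c : R) :
  (forall z, continuous g z) -> (forall t, g (t + 2 * PI) = g t) ->
  RInt g c (c + 2 * PI) = RInt g 0 (2 * PI).
Proof.
  intros Hg HP.
  pose proof (RInt_Chasles_R g c 0 (c + 2 * PI) Hg) as H1.
  pose proof (RInt_Chasles_R g 0 (2 * PI) (c + 2 * PI) Hg) as H2.
  pose proof (RInt_Chasles_R g c 0 c Hg) as H3.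
  pose proof (RInt_translate g (2 * PI) 0 c Hg) as H4.
  rewrite Rplus_0_l, (RInt_extR _ g) in H4 by exact HP.
  rewrite (RInt_point (V := R_CompleteNormedModule)) in H3.
  change (@zero R_CompleteNormedModule) with 0 in H3. lra.
Qed.

Lemma RInt_periodic_translate (g : R -> R) (c : R) :
  (forall z, continuous g z) -> (forall t, g (t + 2 * PI) = g t) ->
  RInt (fun s => g (s + c)) 0 (2 * PI) = RInt g 0 (2 * PI).
Proof.
  intros Hg HP. rewrite RInt_translate by exact Hg.
  rewrite Rplus_0_l, (Rplus_comm (2 * PI)). apply RInt_period_shift; assumption.
Qed.

Lemma periodic_Z (e : R -> R) (t : R) (k : Z) :
  (forall t, e (t + 2 * PI) = e t) -> e (t + IZR k * (2 * PI)) = e t.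
Proof.
  intros H.
  assert (Hn : forall n t, e (t + INR n * (2 * PI)) = e t).
  { induction n as [|n IH]; intros u.
    - simpl. f_equal. ring.
    - rewrite S_INR. replace (u + (INR n + 1) * (2 * PI))
        with (u + INR n * (2 * PI) + 2 * PI) by ring. rewrite H. apply IH. }
  destruct (Z_le_gt_dec 0 k) as [Hk | Hk].
  - rewrite <- (Z2Nat.id k Hk), <- INR_IZR_INZ. apply Hn.
  - rewrite <- (Hn (Z.to_nat (- k)) (t + IZR k * (2 * PI))).
    rewrite INR_IZR_INZ, Z2Nat.id, opp_IZR by lia. f_equal. ring.
Qed.

Lemma cos_periodic (t : R) : cos (t + 2 * PI) = cos t.
Proof. rewrite <- (cos_period t 1). f_equal. simpl. ring. Qed.

Lemma sin_periodic (t : R) : sin (t + 2 * PI) = sin t.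
Proof. rewrite <- (sin_period t 1). f_equal. simpl. ring. Qed.

(** The modes with [n = 0], whose lines have direction [(0, 1)], the only one of the four not of the
    form [(1, a)]. *)
Lemma torus_int_vertical (h : R -> R -> R) (e : R -> R) :
  cont2 h -> line_mean_zero 0 1 h -> torus_int (fun x y => h x y * e x) = 0.
Proof.
  intros Hh H0. apply RInt_zero. intros x.
  transitivity (e x * line_int (fun _ => 1) 0 1 h (2 * PI) x 0).
  - unfold line_int. rewrite <- RInt_mult_l.
    + apply RInt_extR. intros s. replace (x + 0 * s) with x by ring.
      replace (0 + 1 * s) with s by ring. ring.
    + apply (cont2_slice_r (fun _ s => 1 * h (x + 0 * s) (0 + 1 * s)) 0). cont2_tac.
  - rewrite H0. ring.
Qed.

(* The mode [m x + n y] is constant on the lines of direction [(1, a)]; the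
   substitution [y := y + a x] makes these lines horizontal. *)
Lemma torus_int_slanted (h : R -> R -> R) (e : R -> R) (a : R) (m n : Z) :
  cont2 h -> periodic2 h -> (forall t, continuous e t) ->
  (forall t, e (t + 2 * PI) = e t) -> line_mean_zero 1 a h ->
  IZR m + IZR n * a = 0 ->
  torus_int (fun x y => h x y * e (IZR m * x + IZR n * y)) = 0.
Proof.
  intros Hh HP He HPe H0 Hmn. unfold torus_int.
  rewrite (RInt_extR _ (fun x => RInt (fun y => h x (y + a * x) * e (IZR n * y)) 0 (2 * PI))).
  - rewrite (RInt_Fubini (fun x y => h x (y + a * x) * e (IZR n * y)));
      [| apply two_PI_pos | cont2_tac].
    apply RInt_zero. intros y.
    transitivity (e (IZR n * y) * line_int (fun _ => 1) 1 a h (2 * PI) 0 y).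
    + unfold line_int. rewrite <- RInt_mult_l.
      * apply RInt_extR. intros s. replace (0 + 1 * s) with s by ring. ring.
      * apply (cont2_slice_r (fun _ s => 1 * h (0 + 1 * s) (y + a * s)) 0). cont2_tac.
    + rewrite H0. ring.
  - intros x.
    (* For fixed [x] the integrand is [2 PI]-periodic in [y], so [y] may be shifted by [a * x];
       since [m + n a = 0], the phase becomes [n y]. *)
    rewrite <- (RInt_periodic_translate
      (fun y => h x y * e (IZR m * x + IZR n * y)) (a * x)).
    + apply RInt_extR. intros y. f_equal. f_equal.
      replace (IZR m) with (- (IZR n * a)) by lra. ring.
    + apply (cont2_slice_r (fun x y => h x y * e (IZR m * x + IZR n * y)) x). cont2_tac.
    + intros t. f_equal; [apply HP|].
      replace (IZR m * x + IZR n * (t + 2 * PI))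
        with (IZR m * x + IZR n * t + IZR n * (2 * PI)) by ring.
      apply periodic_Z, HPe.
Qed.

Lemma resonant_cases (m n : Z) : resonant m n -> (m = 0 \/ n = 0 \/ m = n \/ m = - n)%Z.
Proof.
  unfold resonant. intros H.
  replace (m * n * (m * m - n * n))%Z with (m * (n * ((m - n) * (m + n))))%Z in H by ring.
  rewrite !Z.mul_eq_0 in H. lia.
Qed.

Lemma line_means_fourier_zero (h : R -> R -> R) (m n : Z) :
  cont2 h -> periodic2 h ->
  line_mean_zero 1 0 h -> line_mean_zero 0 1 h ->
  line_mean_zero 1 1 h -> line_mean_zero 1 (-1) h ->
  resonant m n -> fourier_zero h m n.
Proof.
  intros Hh HP H1 H2 H3 H4 Hmn.
  (* A generic periodic [e] treats real and imaginary parts together. The mode is constant along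
     [(n, -m)], so [m = n] calls for slope -1 and [m = -n] for slope 1. *)
  assert (H : forall e, (forall t, continuous e t) -> (forall t, e (t + 2 * PI) = e t) ->
    torus_int (fun x y => h x y * e (IZR m * x + IZR n * y)) = 0).
  { intros e He HPe. apply resonant_cases in Hmn. destruct Hmn as [-> | [-> | [-> | ->]]].
    - apply torus_int_slanted with 0; try assumption. ring.
    - rewrite (torus_int_ext _ (fun x y => h x y * (fun x => e (IZR m * x)) x)).
      + apply torus_int_vertical; assumption.
      + intros x y. f_equal. f_equal. ring.
    - apply torus_int_slanted with (-1); try assumption. ring.
    - apply torus_int_slanted with 1; try assumption. rewrite opp_IZR. ring. }
  split; apply is_integral2_torus_int; try cont2_tac; apply H;
    auto using continuous_cos, continuous_sin, cos_periodic, sin_periodic.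
Qed.

(** * Completeness of the trigonometric system *)

Lemma RInt_comb5_zero (f1 f2 f3 f4 f5 : R -> R) (c1 c2 c3 c4 c5 a b : R) :
  (forall z, continuous f1 z) -> (forall z, continuous f2 z) ->
  (forall z, continuous f3 z) -> (forall z, continuous f4 z) ->
  (forall z, continuous f5 z) ->
  RInt f1 a b = 0 -> RInt f2 a b = 0 -> RInt f3 a b = 0 -> RInt f4 a b = 0 ->
  RInt f5 a b = 0 ->
  RInt (fun x => c1 * f1 x + (c2 * f2 x + (c3 * f3 x + (c4 * f4 x + c5 * f5 x)))) a b = 0.
Proof.
  intros C1 C2 C3 C4 C5 E1 E2 E3 E4 E5.
  rewrite RInt_add, RInt_add, RInt_add, RInt_add.
  - rewrite !RInt_mult_l, E1, E2, E3, E4, E5 by assumption. to_R. ring.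
  - apply (cont2_slice_r (fun _ x => c4 * f4 x) 0); cont2_tac.
  - apply (cont2_slice_r (fun _ x => c5 * f5 x) 0); cont2_tac.
  - apply (cont2_slice_r (fun _ x => c3 * f3 x) 0); cont2_tac.
  - apply (cont2_slice_r (fun _ x => c4 * f4 x + c5 * f5 x) 0); cont2_tac.
  - apply (cont2_slice_r (fun _ x => c2 * f2 x) 0); cont2_tac.
  - apply (cont2_slice_r (fun _ x => c3 * f3 x + (c4 * f4 x + c5 * f5 x)) 0); cont2_tac.
  - apply (cont2_slice_r (fun _ x => c1 * f1 x) 0); cont2_tac.
  - apply (cont2_slice_r (fun _ x => c2 * f2 x + (c3 * f3 x + (c4 * f4 x + c5 * f5 x))) 0);
      cont2_tac.
Qed.

(** A trigonometric polynomial of degree one with maximum at [x0]; its powers are the concentrating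
    kernels of the classical completeness proof. *)
Definition peak (x0 c t : R) : R := 1 + cos (t - x0) - c.

Lemma continuous_peak_pow (x0 c : R) (n : nat) (t : R) :
  continuous (fun t => peak x0 c t ^ n) t.
Proof.
  induction n as [|n IH]; simpl.
  - apply continuous_const.
  - apply (continuous_mult (K := R_AbsRing)); [|exact IH].
    apply (cont2_slice_r (fun _ t => peak x0 c t) 0). unfold peak. cont2_tac.
Qed.

Definition orthogonal_to_trig (g : R -> R) : Prop :=
  forall k : Z, RInt (fun t => g t * cos (IZR k * t)) 0 (2 * PI) = 0 /\
                RInt (fun t => g t * sin (IZR k * t)) 0 (2 * PI) = 0.

(** Multiplication by [cos (t - x0)] turns frequency [k] into [k + 1] and [k - 1]. The
    product-to-sum formulas produce five modes, with the coefficients listed in the proof. *)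
Lemma orthogonal_peak (g : R -> R) (x0 c : R) :
  (forall z, continuous g z) -> orthogonal_to_trig g ->
  orthogonal_to_trig (fun t => g t * peak x0 c t).
Proof.
  intros Hg H k.
  destruct (H k) as [H1 H2]. destruct (H (k + 1)%Z) as [H3 H4].
  destruct (H (k - 1)%Z) as [H5 H6].
  assert (C : forall l : Z, forall z, continuous (fun t => g t * cos (IZR l * t)) z).
  { intros l. apply (cont2_slice_r (fun _ t => g t * cos (IZR l * t)) 0). cont2_tac. }
  assert (D : forall l : Z, forall z, continuous (fun t => g t * sin (IZR l * t)) z).
  { intros l. apply (cont2_slice_r (fun _ t => g t * sin (IZR l * t)) 0). cont2_tac. }
  assert (Ep : forall t, IZR (k + 1) * t = IZR k * t + t) by (intros; rewrite plus_IZR; ring).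
  assert (Em : forall t, IZR (k - 1) * t = IZR k * t - t) by (intros; rewrite minus_IZR; ring).
  split.
  - refine (eq_trans _ (RInt_comb5_zero _ _ _ _ _ (1 - c) (cos x0 / 2) (cos x0 / 2) (sin x0 / 2)
      (- sin x0 / 2) 0 (2 * PI) (C k) (C (k + 1)%Z) (C (k - 1)%Z) (D (k + 1)%Z) (D (k - 1)%Z)
      H1 H3 H5 H4 H6)).
    apply RInt_extR. intros t. unfold peak.
    rewrite Ep, Em, !cos_minus, !cos_plus, !sin_plus, !sin_minus. field.
  - refine (eq_trans _ (RInt_comb5_zero _ _ _ _ _ (1 - c) (cos x0 / 2) (cos x0 / 2) (- sin x0 / 2)
      (sin x0 / 2) 0 (2 * PI) (D k) (D (k + 1)%Z) (D (k - 1)%Z) (C (k + 1)%Z) (C (k - 1)%Z)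
      H2 H4 H6 H3 H5)).
    apply RInt_extR. intros t. unfold peak.
    rewrite Ep, Em, !cos_minus, !cos_plus, !sin_plus, !sin_minus. field.
Qed.

Lemma orthogonal_peak_pow (g : R -> R) (x0 c : R) (n : nat) :
  (forall z, continuous g z) -> orthogonal_to_trig g ->
  RInt (fun t => g t * peak x0 c t ^ n) 0 (2 * PI) = 0.
Proof.
  intros Hg H.
  assert (Hn : orthogonal_to_trig (fun t => g t * peak x0 c t ^ n)).
  { induction n as [|n IH].
    - intros k. destruct (H k) as [H1 H2]. simpl.
      split; [refine (eq_trans _ H1) | refine (eq_trans _ H2)];
        apply RInt_extR; intros t; ring.
    - apply (orthogonal_peak _ x0 c) in IH.
      + intros k. destruct (IH k) as [H1 H2]. simpl.
        split; [refine (eq_trans _ H1) | refine (eq_trans _ H2)];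
          apply RInt_extR; intros t; ring.
      + intros z. apply (continuous_mult (K := R_AbsRing)); [apply Hg|].
        apply continuous_peak_pow. }
  destruct (Hn 0%Z) as [H1 _]. refine (eq_trans _ H1).
  apply RInt_extR. intros t. rewrite Rmult_0_l, cos_0. ring.
Qed.

Lemma RInt_ge_const (f : R -> R) (a b m : R) :
  a <= b -> (forall z, continuous f z) -> (forall t, a <= t <= b -> m <= f t) ->
  (b - a) * m <= RInt f a b.
Proof.
  intros Hab Hf H.
  replace ((b - a) * m) with (RInt (fun _ => m) a b).
  - apply RInt_le; [exact Hab | apply ex_RInt_const | apply ex_RInt_cont, Hf |].
    intros t Ht. apply H. lra.
  - rewrite RInt_const. reflexivity.
Qed.

Lemma cos_le_abs (t d : R) : 0 <= d <= Rabs t -> Rabs t <= PI -> cos t <= cos d.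
Proof.
  intros Hd Ht.
  replace (cos t) with (cos (Rabs t)).
  - apply cos_decr_1; lra.
  - unfold Rabs. destruct (Rcase_abs t); [apply cos_neg | reflexivity].
Qed.

Lemma cos_ge_abs (t d : R) : Rabs t <= d -> d <= PI -> cos d <= cos t.
Proof.
  intros Hd Ht. pose proof (Rabs_pos t).
  replace (cos t) with (cos (Rabs t)).
  - apply cos_decr_1; lra.
  - unfold Rabs. destruct (Rcase_abs t); [apply cos_neg | reflexivity].
Qed.

Lemma pow_abs_le_1 (x : R) (n : nat) : Rabs x <= 1 -> Rabs (x ^ n) <= 1.
Proof.
  intros H. rewrite <- RPow_abs, <- (pow1 n). apply pow_incr.
  split; [apply Rabs_pos | exact H].
Qed.

(* The powers of [peak x0 (cos d)] grow geometrically near [x0] and stay bounded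
   by 1 at distance at least [d]. *)
Lemma peak_integrals_not_all_zero (g : R -> R) (x0 : R) :
  (forall z, continuous g z) -> 0 < g x0 ->
  ~ forall c n, RInt (fun t => g t * peak x0 c t ^ n) (x0 - PI) (x0 + PI) = 0.
Proof.
  intros Hg Hpos H. pose proof PI_RGT_0 as Hpi.
  destruct (cont_abs_bounded g (x0 - PI) (x0 + PI) ltac:(lra) Hg) as [B [HB Hb]].
  assert (Hc := proj2 (continuity_pt_filterlim g x0) (Hg x0)).
  destruct (Hc (g x0 / 2) ltac:(lra)) as [d0 [Hd0 Hc']].
  (* Within distance [d] of [x0] the function [g] stays above half of [g x0], and [cos] is
     decreasing on [[0, d]]. *)
  set (d := Rmin (d0 / 2) (PI / 2)).
  assert (Hd : 0 < d) by (apply Rmin_pos; lra).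
  assert (Hd1 : d <= d0 / 2) by apply Rmin_l.
  assert (Hd2 : d <= PI / 2) by apply Rmin_r.
  assert (Hnear : forall t, Rabs (t - x0) <= d -> g x0 / 2 <= g t).
  { intros t Ht. destruct (Req_dec t x0) as [-> | Hne]; [lra|].
    assert (Hdist : Rabs (g t - g x0) < g x0 / 2).
    { apply (Hc' t). split; [split; [exact I | auto]|]. simpl. unfold Rdist. lra. }
    apply Rabs_lt_between in Hdist. lra. }
  (* The value of the peak at distance [d / 2], hence its minimum on the inner interval. *)
  set (q := 1 + cos (d / 2) - cos d).
  assert (Hq : 1 < q).
  { unfold q. assert (cos d < cos (d / 2)) by (apply cos_decreasing_1; lra). lra. }
  assert (Hcd : 0 <= cos d) by (apply cos_ge_0; lra).
  assert (Hcd1 : cos d <= 1) by apply COS_bound.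
  (* [N] is chosen so that the inner interval, of length [d], contributes at least [2 PI B + 1],
     more than the loss of at most [B] per unit length elsewhere. *)
  destruct (Pow_x_infinity q ltac:(rewrite Rabs_pos_eq; lra)
    ((2 * PI * B + 1) / (d * (g x0 / 2)))) as [N HN].
  specialize (HN N (Nat.le_refl N)).
  rewrite Rabs_pos_eq in HN by (apply pow_le; lra).
  set (f := fun t => g t * peak x0 (cos d) t ^ N).
  assert (Cf : forall z, continuous f z).
  { intros z. apply (continuous_mult (K := R_AbsRing)); [apply Hg | apply continuous_peak_pow]. }
  assert (Hout : forall t, x0 - PI <= t <= x0 + PI -> - B <= f t).
  { intros t Ht. destruct (Rle_lt_dec (Rabs (t - x0)) d) as [Hin | Hfar].
    - apply Rle_trans with 0; [lra|]. apply Rmult_le_pos; [specialize (Hnear t Hin); lra|].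
      apply pow_le. unfold peak.
      pose proof (cos_ge_abs (t - x0) d Hin ltac:(lra)). lra.
    - assert (Ha : Rabs (f t) <= B * 1).
      { unfold f. rewrite Rabs_mult. apply Rmult_le_compat; try apply Rabs_pos.
        - apply Hb, Ht.
        - apply pow_abs_le_1. unfold peak.
          assert (Rabs (t - x0) <= PI) by (apply Rabs_le_between; lra).
          pose proof (cos_le_abs (t - x0) d ltac:(lra) ltac:(lra)).
          pose proof (COS_bound (t - x0)). apply Rabs_le_between. lra. }
      apply Rabs_le_between in Ha. lra. }
  assert (Hin : forall t, x0 - d / 2 <= t <= x0 + d / 2 -> g x0 / 2 * q ^ N <= f t).
  { intros t Ht. assert (Ha : Rabs (t - x0) <= d / 2) by (apply Rabs_le_between; lra).
    apply Rmult_le_compat; [lra | apply pow_le; lra | apply Hnear; lra |].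
    apply pow_incr. split; [lra|]. unfold q, peak.
    pose proof (cos_ge_abs (t - x0) (d / 2) Ha ltac:(lra)). lra. }
  pose proof (RInt_ge_const f (x0 - PI) (x0 - d / 2) (- B) ltac:(lra) Cf
    ltac:(intros; apply Hout; lra)) as I1.
  pose proof (RInt_ge_const f (x0 - d / 2) (x0 + d / 2) _ ltac:(lra) Cf Hin) as I2.
  pose proof (RInt_ge_const f (x0 + d / 2) (x0 + PI) (- B) ltac:(lra) Cf
    ltac:(intros; apply Hout; lra)) as I3.
  pose proof (RInt_Chasles_R f (x0 - PI) (x0 - d / 2) (x0 + PI) Cf) as E1.
  pose proof (RInt_Chasles_R f (x0 - d / 2) (x0 + d / 2) (x0 + PI) Cf) as E2.
  specialize (H (cos d) N). fold f in H. rewrite H in E1.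
  assert (HN' : 2 * PI * B + 1 <= d * (g x0 / 2) * q ^ N).
  { apply Rge_le in HN. apply Rmult_le_compat_l with (r := d * (g x0 / 2)) in HN.
    - replace (d * (g x0 / 2) * ((2 * PI * B + 1) / (d * (g x0 / 2))))
        with (2 * PI * B + 1) in HN by (field; lra). exact HN.
    - apply Rmult_le_pos; lra. }
  replace ((x0 + d / 2 - (x0 - d / 2)) * (g x0 / 2 * q ^ N))
    with (d * (g x0 / 2) * q ^ N) in I2 by field.
  assert (0 <= d * B) by (apply Rmult_le_pos; lra). nra.
Qed.

(** A positive value of [g] contradicts orthogonality to the powers of a peak centred there, the
    window being moved by periodicity; [- g] excludes negative values. *)
Lemma fourier_complete_1d (g : R -> R) :
  (forall z, continuous g z) -> (forall t, g (t + 2 * PI) = g t) ->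
  orthogonal_to_trig g -> forall x, g x = 0.
Proof.
  assert (Hle : forall g, (forall z, continuous g z) -> (forall t, g (t + 2 * PI) = g t) ->
    orthogonal_to_trig g -> forall x, g x <= 0).
  { clear g. intros g Hg HP H x. apply Rnot_lt_le. intros Hpos.
    apply (peak_integrals_not_all_zero g x Hg Hpos). intros c n.
    replace (x + PI) with (x - PI + 2 * PI) by ring.
    rewrite RInt_period_shift.
    - apply orthogonal_peak_pow; assumption.
    - intros z. apply (continuous_mult (K := R_AbsRing)); [apply Hg | apply continuous_peak_pow].
    - intros t. rewrite HP. unfold peak.
      replace (t + 2 * PI - x) with (t - x + 2 * PI) by ring.
      rewrite cos_periodic. reflexivity. }
  intros Hg HP H x. apply Rle_antisym; [apply Hle; assumption|].
  enough (- g x <= 0) by lra. apply (Hle (fun t => - g t)).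
  - apply (cont2_slice_r (fun _ t => - g t) 0). cont2_tac.
  - intros t. rewrite HP. reflexivity.
  - intros k. destruct (H k) as [H1 H2]. split.
    + rewrite (RInt_extR _ (fun t => -1 * (g t * cos (IZR k * t)))) by (intros; ring).
      rewrite RInt_mult_l, H1 by
        (apply (cont2_slice_r (fun _ t => g t * cos (IZR k * t)) 0); cont2_tac).
      to_R. ring.
    + rewrite (RInt_extR _ (fun t => -1 * (g t * sin (IZR k * t)))) by (intros; ring).
      rewrite RInt_mult_l, H2 by
        (apply (cont2_slice_r (fun _ t => g t * sin (IZR k * t)) 0); cont2_tac).
      to_R. ring.
Qed.

(** The one-dimensional result is applied twice: in [x] to the integrals of [h] against a fixed mode
    in [y], then in [y] to the slices of [h]. *)
Lemma fourier_complete_2d (h : R -> R -> R) :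
  cont2 h -> periodic2 h ->
  (forall m n : Z, torus_int (fun x y => h x y * cos (IZR m * x + IZR n * y)) = 0 /\
                   torus_int (fun x y => h x y * sin (IZR m * x + IZR n * y)) = 0) ->
  forall x y, h x y = 0.
Proof.
  intros Hh HP H x.
  (* With [k] equal to 1 or -1, these half-sums of the modes [(m, n)] and [(m, -n)] give the
     products of a mode in [x] and a mode in [y]. *)
  assert (Hlin : forall (k : R) (f g : R -> R -> R), cont2 f -> cont2 g ->
    torus_int f = 0 -> torus_int g = 0 ->
    torus_int (fun x y => / 2 * (f x y + k * g x y)) = 0).
  { intros k f g Cf Cg Ef Eg.
    rewrite torus_int_mult_l by cont2_tac. rewrite torus_int_add by cont2_tac.
    rewrite torus_int_mult_l, Ef, Eg by assumption. ring. }
  assert (Hslice : forall e : R -> R, (forall t, continuous e t) ->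
    (forall m : Z,
      torus_int (fun x y => h x y * e y * cos (IZR m * x)) = 0 /\
      torus_int (fun x y => h x y * e y * sin (IZR m * x)) = 0) ->
    RInt (fun y => h x y * e y) 0 (2 * PI) = 0).
  { intros e He Hm.
    apply (fourier_complete_1d (fun x => RInt (fun y => h x y * e y) 0 (2 * PI))).
    - apply (continuous_RInt_param (fun x y => h x y * e y)). cont2_tac.
    - intros t. apply RInt_extR. intros y. rewrite (proj1 (HP t y)). reflexivity.
    - assert (Cs : forall z s, continuous (fun y => h z y * e y) s).
      { intros z. apply (cont2_slice_r (fun x y => h x y * e y) z). cont2_tac. }
      intros k. destruct (Hm k) as [H1 H2]. split.
      + refine (eq_trans _ H1). apply RInt_extR. intros u.
        rewrite Rmult_comm, <- RInt_mult_l by apply Cs. apply RInt_extR. intros y. ring.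
      + refine (eq_trans _ H2). apply RInt_extR. intros u.
        rewrite Rmult_comm, <- RInt_mult_l by apply Cs. apply RInt_extR. intros y. ring. }
  assert (CC : forall m n : Z, cont2 (fun x y => h x y * cos (IZR m * x + IZR n * y)))
    by (intros; cont2_tac).
  assert (CS : forall m n : Z, cont2 (fun x y => h x y * sin (IZR m * x + IZR n * y)))
    by (intros; cont2_tac).
  assert (Eo : forall (m n : Z) x y, IZR m * x + IZR (- n) * y = IZR m * x - IZR n * y)
    by (intros; rewrite opp_IZR; ring).
  apply fourier_complete_1d.
  - apply cont2_slice_r, Hh.
  - intros t. apply HP.
  - intros n. split; apply Hslice.
    + apply (cont2_slice_r (fun _ t => cos (IZR n * t)) 0). cont2_tac.
    + intros m. destruct (H m n) as [H1 H2]. destruct (H m (- n)%Z) as [H3 H4]. split.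
      * rewrite <- (Hlin 1 _ _ (CC m n) (CC m (- n)%Z) H1 H3). apply torus_int_ext.
        intros u v. rewrite Eo, cos_plus, cos_minus. field.
      * rewrite <- (Hlin 1 _ _ (CS m n) (CS m (- n)%Z) H2 H4). apply torus_int_ext.
        intros u v. rewrite Eo, sin_plus, sin_minus. field.
    + apply (cont2_slice_r (fun _ t => sin (IZR n * t)) 0). cont2_tac.
    + intros m. destruct (H m n) as [H1 H2]. destruct (H m (- n)%Z) as [H3 H4]. split.
      * rewrite <- (Hlin (-1) _ _ (CS m n) (CS m (- n)%Z) H2 H4). apply torus_int_ext.
        intros u v. rewrite Eo, sin_plus, sin_minus. field.
      * rewrite <- (Hlin (-1) _ _ (CC m (- n)%Z) (CC m n) H3 H1). apply torus_int_ext.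
        intros u v. rewrite Eo, cos_plus, cos_minus. field.
Qed.

(** * Uniqueness and symmetry *)

Lemma RInt_derive_periodic (f f' : R -> R) :
  (forall t, is_derive f t (f' t)) -> (forall t, continuous f' t) ->
  (forall t, f (t + 2 * PI) = f t) -> RInt f' 0 (2 * PI) = 0.
Proof.
  intros Hd Hc HP.
  rewrite (is_RInt_unique (V := R_CompleteNormedModule) _ _ _ _
    (is_RInt_derive (V := R_CompleteNormedModule) f f' 0 (2 * PI)
      (fun t _ => Hd t) (fun t _ => Hc t))).
  unfold minus, plus, opp; simpl. rewrite <- (Rplus_0_l (2 * PI)), HP. to_R. ring.
Qed.

Lemma torus_int_dy (h h' : R -> R -> R) :
  (forall x y, is_derive (fun t => h x t) y (h' x y)) -> cont2 h' -> periodic2 h ->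
  torus_int h' = 0.
Proof.
  intros Hd Hc HP. apply RInt_zero. intros x.
  apply (RInt_derive_periodic (fun y => h x y)).
  - apply Hd.
  - apply cont2_slice_r, Hc.
  - intros t; apply HP.
Qed.

Lemma torus_int_dx (h h' : R -> R -> R) :
  (forall x y, is_derive (fun t => h t y) x (h' x y)) -> cont2 h' -> periodic2 h ->
  torus_int h' = 0.
Proof.
  intros Hd Hc HP. unfold torus_int.
  rewrite RInt_Fubini; [| apply two_PI_pos | exact Hc].
  apply (torus_int_dy (fun y x => h x y) (fun y x => h' x y)).
  - intros; apply Hd.
  - apply cont2_swap, Hc.
  - intros x y; split; apply HP.
Qed.

Lemma periodic2_mode (f : R -> R -> R) (e : R -> R) (m n : Z) :
  periodic2 f -> (forall t, e (t + 2 * PI) = e t) ->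
  periodic2 (fun x y => f x y * e (IZR m * x + IZR n * y)).
Proof.
  intros HP He x y. split; f_equal; try apply HP.
  - replace (IZR m * (x + 2 * PI) + IZR n * y)
      with (IZR m * x + IZR n * y + IZR m * (2 * PI)) by ring.
    apply periodic_Z, He.
  - replace (IZR m * x + IZR n * (y + 2 * PI))
      with (IZR m * x + IZR n * y + IZR n * (2 * PI)) by ring.
    apply periodic_Z, He.
Qed.

(** The derivative of a periodic product has integral zero over the torus, so no boundary terms
    appear. *)
Lemma torus_int_by_parts (F : nat -> nat -> R -> R -> R) (e e' : R -> R) (m n : Z) (i j : nat) :
  smooth_family F -> periodic2 (F i j) ->
  (forall t, is_derive e t (e' t)) -> (forall t, continuous e' t) ->
  (forall t, e (t + 2 * PI) = e t) ->
  torus_int (fun x y => F (S i) j x y * e (IZR m * x + IZR n * y)) =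
    - IZR m * torus_int (fun x y => F i j x y * e' (IZR m * x + IZR n * y)) /\
  torus_int (fun x y => F i (S j) x y * e (IZR m * x + IZR n * y)) =
    - IZR n * torus_int (fun x y => F i j x y * e' (IZR m * x + IZR n * y)).
Proof.
  intros HF HP Hd Hc He.
  pose proof (smooth_cont2 F i j HF). pose proof (smooth_cont2 F (S i) j HF).
  pose proof (smooth_cont2 F i (S j) HF).
  assert (Ce : forall t, continuous e t).
  { intros t. apply (ex_derive_continuous (K := R_AbsRing) (V := R_NormedModule) e).
    eexists; apply Hd. }
  assert (Hcomp : forall c d t, is_derive (fun t => e (c * t + d)) t (c * e' (c * t + d))).
  { intros c d t.
    apply (is_derive_comp e (fun t => c * t + d)); [apply Hd|].
    auto_derive; [exact I | ring]. }
  assert (Hper := periodic2_mode (F i j) e m n HP He).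
  split.
  - pose proof (torus_int_dx _ (fun x y =>
      F (S i) j x y * e (IZR m * x + IZR n * y)
      + IZR m * (F i j x y * e' (IZR m * x + IZR n * y))) ltac:(
        intros x y;
        pose proof (is_derive_mult_R (fun t => F i j t y) _ _ _ _
          (smooth_dx F i j x y HF) (Hcomp (IZR m) (IZR n * y) x)) as E;
        refine (eq_ind _ (is_derive _ x) E _ _); to_R; ring)
      ltac:(cont2_tac) Hper) as E.
    rewrite torus_int_add, torus_int_mult_l in E by cont2_tac. lra.
  - pose proof (torus_int_dy _ (fun x y =>
      F i (S j) x y * e (IZR m * x + IZR n * y)
      + IZR n * (F i j x y * e' (IZR m * x + IZR n * y))) ltac:(
        intros x y;
        pose proof (is_derive_mult_R (fun t => F i j x t) _ _ _ _
          (smooth_dy F i j x y HF) (Hcomp (IZR n) (IZR m * x) y)) as E;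
        apply (is_derive_ext (fun t => F i j x t * e (IZR n * t + IZR m * x)));
        [intros t; rewrite (Rplus_comm (IZR n * t)); reflexivity |];
        refine (eq_ind _ (is_derive _ y) E _ _); to_R;
        rewrite (Rplus_comm (IZR n * y)); ring)
      ltac:(cont2_tac) Hper) as E.
    rewrite torus_int_add, torus_int_mult_l in E by cont2_tac. lra.
Qed.

Lemma homogeneous_solution_zero (D : nat -> nat -> R -> R -> R) :
  smooth_family D -> periodic2 (D 0%nat 0%nat) ->
  (forall m n, resonant m n -> fourier_zero (D 0%nat 0%nat) m n) ->
  (forall x y, D 3%nat 1%nat x y - D 1%nat 3%nat x y = 0) ->
  forall x y, D 0%nat 0%nat x y = 0.
Proof.
  intros HD HP H0 Heq.
  assert (HPD := smooth_periodic D HD HP).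
  pose proof (smooth_cont2 D 0 0 HD) as C00.
  apply fourier_complete_2d; [exact C00 | exact HP |].
  intros m n.
  destruct (Z.eq_dec (m * n * (m * m - n * n)) 0) as [Hres | Hres].
  { destruct (H0 m n Hres) as [H1 H2].
    split; apply is_integral2_torus_int; try assumption; cont2_tac. }
  (* The symbol of the operator at the mode [(m, n)]. *)
  assert (Hk : IZR m ^ 3 * IZR n - IZR m * IZR n ^ 3 <> 0).
  { replace (IZR m ^ 3 * IZR n - IZR m * IZR n ^ 3)
      with (IZR (m * n * (m * m - n * n))).
    - apply eq_IZR_contrapositive, Hres.
    - rewrite !mult_IZR, minus_IZR, !mult_IZR. ring. }
  pose (c := fun i j => torus_int (fun x y => D i j x y * cos (IZR m * x + IZR n * y))).
  pose (s := fun i j => torus_int (fun x y => D i j x y * sin (IZR m * x + IZR n * y))).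
  assert (Hs : forall i j, s (S i) j = - IZR m * c i j /\ s i (S j) = - IZR n * c i j).
  { intros i j. apply (torus_int_by_parts D sin cos m n i j HD (HPD i j)).
    - intros t. apply is_derive_Reals, derivable_pt_lim_sin.
    - apply continuous_cos.
    - apply sin_periodic. }
  assert (Hc : forall i j, c (S i) j = IZR m * s i j /\ c i (S j) = IZR n * s i j).
  { intros i j.
    pose proof (smooth_cont2 D i j HD).
    assert (E : torus_int (fun x y => D i j x y * - sin (IZR m * x + IZR n * y)) = - s i j).
    { unfold s. rewrite (torus_int_ext _
        (fun x y => -1 * (D i j x y * sin (IZR m * x + IZR n * y)))) by (intros; ring).
      rewrite torus_int_mult_l by cont2_tac. ring. }
    destruct (torus_int_by_parts D cos (fun t => - sin t) m n i j HD (HPD i j)) as [E1 E2].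
    - intros t. apply is_derive_Reals, derivable_pt_lim_cos.
    - intros t. apply (cont2_slice_r (fun _ t => - sin t) 0). cont2_tac.
    - apply cos_periodic.
    - cbv beta in E1, E2. rewrite E in E1, E2. unfold c. rewrite E1, E2. split; ring. }
  assert (Hdiff : forall e : R -> R,
    torus_int (fun x y => D 3%nat 1%nat x y * e (IZR m * x + IZR n * y)) =
    torus_int (fun x y => D 1%nat 3%nat x y * e (IZR m * x + IZR n * y))).
  { intros e. apply torus_int_ext. intros x y.
    replace (D 3%nat 1%nat x y) with (D 1%nat 3%nat x y) by (specialize (Heq x y); lra).
    reflexivity. }
  assert (Hc31 : c 3%nat 1%nat = c 1%nat 3%nat) by apply Hdiff.
  assert (Hs31 : s 3%nat 1%nat = s 1%nat 3%nat) by apply Hdiff.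
  split.
  - change (c 0%nat 0%nat = 0).
    (* The operator has order four: four integrations by parts lead from cosine back to cosine, with
       two minus signs that cancel. *)
    rewrite (proj1 (Hc 2%nat 1%nat)), (proj1 (Hs 1%nat 1%nat)), (proj1 (Hc 0%nat 1%nat)),
      (proj2 (Hs 0%nat 0%nat)), (proj1 (Hc 0%nat 3%nat)), (proj2 (Hs 0%nat 2%nat)),
      (proj2 (Hc 0%nat 1%nat)), (proj2 (Hs 0%nat 0%nat)) in Hc31.
    apply Rmult_eq_reg_l with (IZR m ^ 3 * IZR n - IZR m * IZR n ^ 3); [|exact Hk].
    rewrite Rmult_0_r, Rmult_minus_distr_r.
    apply Rminus_diag_eq.
    transitivity (IZR m * (- IZR m * (IZR m * (- IZR n * c 0%nat 0%nat)))); [ring|].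
    rewrite Hc31. ring.
  - change (s 0%nat 0%nat = 0).
    rewrite (proj1 (Hs 2%nat 1%nat)), (proj1 (Hc 1%nat 1%nat)), (proj1 (Hs 0%nat 1%nat)),
      (proj2 (Hc 0%nat 0%nat)), (proj1 (Hs 0%nat 3%nat)), (proj2 (Hc 0%nat 2%nat)),
      (proj2 (Hs 0%nat 1%nat)), (proj2 (Hc 0%nat 0%nat)) in Hs31.
    apply Rmult_eq_reg_l with (IZR m ^ 3 * IZR n - IZR m * IZR n ^ 3); [|exact Hk].
    rewrite Rmult_0_r, Rmult_minus_distr_r.
    apply Rminus_diag_eq.
    transitivity (- IZR m * (IZR m * (- IZR m * (IZR n * s 0%nat 0%nat)))); [ring|].
    rewrite Hs31. ring.
Qed.

Lemma fourier_zero_sub (f g : R -> R -> R) (m n : Z) :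
  cont2 f -> cont2 g -> fourier_zero f m n -> fourier_zero g m n ->
  fourier_zero (fun x y => f x y - g x y) m n.
Proof.
  intros Hf Hg [F1 F2] [G1 G2].
  apply is_integral2_torus_int in F1, F2, G1, G2; try cont2_tac.
  assert (Hsub : forall u v : R -> R -> R, cont2 u -> cont2 v ->
    torus_int u = 0 -> torus_int v = 0 -> torus_int (fun x y => u x y + -1 * v x y) = 0).
  { intros u v Cu Cv Eu Ev.
    rewrite torus_int_add, torus_int_mult_l, Eu, Ev by cont2_tac. ring. }
  split; apply is_integral2_torus_int; try cont2_tac.
  - rewrite <- (Hsub (fun x y => f x y * cos (IZR m * x + IZR n * y))
      (fun x y => g x y * cos (IZR m * x + IZR n * y))
      ltac:(cont2_tac) ltac:(cont2_tac) F1 G1).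
    apply torus_int_ext. intros; ring.
  - rewrite <- (Hsub (fun x y => f x y * sin (IZR m * x + IZR n * y))
      (fun x y => g x y * sin (IZR m * x + IZR n * y))
      ltac:(cont2_tac) ltac:(cont2_tac) F2 G2).
    apply torus_int_ext. intros; ring.
Qed.

Lemma solution_unique (A B : nat -> nat -> R -> R -> R) :
  smooth_family A -> periodic2 (A 0%nat 0%nat) ->
  (forall m n, resonant m n -> fourier_zero (A 0%nat 0%nat) m n) ->
  smooth_family B -> periodic2 (B 0%nat 0%nat) ->
  (forall m n, resonant m n -> fourier_zero (B 0%nat 0%nat) m n) ->
  (forall x y, A 3%nat 1%nat x y - A 1%nat 3%nat x y = B 3%nat 1%nat x y - B 1%nat 3%nat x y) ->
  forall x y, A 0%nat 0%nat x y = B 0%nat 0%nat x y.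
Proof.
  intros HA PA ZA HB PB ZB E x y.
  apply Rminus_diag_uniq.
  apply (homogeneous_solution_zero (fun i j x y => A i j x y - B i j x y)).
  - apply smooth_sub; assumption.
  - intros u v. destruct (PA u v) as [E1 E2], (PB u v) as [E3 E4].
    rewrite E1, E2, E3, E4. split; reflexivity.
  - intros m n Hmn. apply fourier_zero_sub; auto using smooth_cont2.
  - intros u v. specialize (E u v). lra.
Qed.

(** The reflection about [c / 2] maps a period to a period, so the integral equals its own
    opposite. *)
Lemma RInt_antireflect (g : R -> R) (c : R) :
  (forall z, continuous g z) -> (forall t, g (t + 2 * PI) = g t) ->
  (forall s, g (c - s) = - g s) -> RInt g 0 (2 * PI) = 0.
Proof.
  intros Hg HP Hr.
  pose proof (RInt_reflect g 0 (2 * PI) c Hg) as E.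
  pose proof (RInt_period_shift g (c - 2 * PI) Hg HP) as E2.
  replace (c - 2 * PI + 2 * PI) with (c - 0) in E2 by ring. rewrite E2 in E.
  rewrite (RInt_extR _ (fun s => -1 * g s)), RInt_mult_l in E; [lra | exact Hg |].
  intros s. rewrite Hr. ring.
Qed.

Definition antisymmetric3 (f : R -> R -> R) : Prop :=
  forall x y, f (- x) y = - f x y /\ f x (- y) = - f x y /\ f y x = - f x y.

(* Each line of one of the four directions carries a reflection, composed of the
   given symmetries, which reverses the sign of [f]. *)
Lemma antisymmetric_line_means (f : R -> R -> R) :
  cont2 f -> periodic2 f -> antisymmetric3 f ->
  line_mean_zero 1 0 f /\ line_mean_zero 0 1 f /\
  line_mean_zero 1 1 f /\ line_mean_zero 1 (-1) f.
Proof.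
  intros Hf HP HA.
  assert (Hm : forall a b, (forall u v, f (u + a * (2 * PI)) (v + b * (2 * PI)) = f u v) ->
    (forall x y, exists c, forall s,
      f (x + a * (c - s)) (y + b * (c - s)) = - f (x + a * s) (y + b * s)) ->
    line_mean_zero a b f).
  { intros a b Hab Hc x y. destruct (Hc x y) as [c Hc'].
    unfold line_int.
    rewrite (RInt_extR _ (fun s => f (x + a * s) (y + b * s))) by (intros; ring).
    apply (RInt_antireflect (fun s => f (x + a * s) (y + b * s)) c).
    - apply (cont2_slice_r (fun _ s => f (x + a * s) (y + b * s)) 0). cont2_tac.
    - intros t. rewrite <- (Hab (x + a * t) (y + b * t)). f_equal; ring.
    - exact Hc'. }
  assert (Hper : forall u v, f (u - 2 * PI) v = f u v /\ f u (v - 2 * PI) = f u v).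
  { intros u v. rewrite <- (proj1 (HP (u - 2 * PI) v)), <- (proj2 (HP u (v - 2 * PI))).
    split; f_equal; ring. }
  split; [|split; [|split]]; apply Hm.
  - intros u v. rewrite <- (proj1 (HP u v)). f_equal; ring.
  - intros x y. exists (- 2 * x). intros s.
    rewrite <- (proj1 (HA _ _)). f_equal; ring.
  - intros u v. rewrite <- (proj2 (HP u v)). f_equal; ring.
  - intros x y. exists (- 2 * y). intros s.
    rewrite <- (proj1 (proj2 (HA _ _))). f_equal; ring.
  - intros u v. rewrite Rmult_1_l, (proj2 (HP _ _)). apply HP.
  (* The reflection is [(u, v)] to [(-v, -u)]: the swap and both sign changes, hence three factors
     -1. For direction [(1, -1)] the swap alone suffices. *)
  - intros x y. exists (- x - y). intros s.
    rewrite <- (proj2 (proj2 (HA _ _))).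
    rewrite <- (Ropp_involutive (f (y + 1 * s) _)), <- (proj1 (HA _ _)).
    rewrite <- (proj1 (proj2 (HA _ _))). f_equal; ring.
  - intros u v. rewrite Rmult_1_l, (proj1 (HP _ _)).
    rewrite <- (proj2 (Hper u v)). f_equal; ring.
  - intros x y. exists (y - x). intros s.
    rewrite <- (proj2 (proj2 (HA _ _))). f_equal; ring.
Qed.

Lemma solvable_antisymmetric (F : nat -> nat -> R -> R -> R) :
  smooth_family F -> periodic2 (F 0%nat 0%nat) -> antisymmetric3 (F 0%nat 0%nat) ->
  solvable_family F.
Proof.
  intros HF HP HA.
  destruct (antisymmetric_line_means _ (smooth_cont2 F 0 0 HF) HP HA) as [H1 [H2 [H3 H4]]].
  split; [exact HF | split; [apply smooth_periodic; assumption|]].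
  intros i j. split; [|split; [|split]]; apply line_mean_zero_family; assumption.
Qed.

(** The same segment traversed from its other end. Reflections map the four directions to each other
    only up to orientation, which this corrects. *)
Lemma line_mean_zero_opp (a b : R) (f : R -> R -> R) :
  cont2 f -> line_mean_zero a b f -> line_mean_zero (- a) (- b) f.
Proof.
  intros Hf H x y. rewrite <- (H (x - a * (2 * PI)) (y - b * (2 * PI))).
  unfold line_int.
  pose proof (RInt_reflect (fun s =>
    1 * f (x - a * (2 * PI) + a * s) (y - b * (2 * PI) + b * s)) 0 (2 * PI) (2 * PI)
    ltac:(apply (cont2_slice_r (fun _ s =>
      1 * f (x - a * (2 * PI) + a * s) (y - b * (2 * PI) + b * s)) 0); cont2_tac)) as E.
  replace (2 * PI - 2 * PI) with 0 in E by ring. rewrite Rminus_0_r in E. rewrite <- E.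
  apply RInt_extR. intros s. f_equal. f_equal; ring.
Qed.

Lemma solvable_fourier_zero (F : nat -> nat -> R -> R -> R) (i j : nat) (m n : Z) :
  solvable_family F -> resonant m n -> fourier_zero (F i j) m n.
Proof.
  intros [HF [HP Hm]] Hmn. destruct (Hm i j) as [H1 [H2 [H3 H4]]].
  apply line_means_fourier_zero; auto using smooth_cont2.
Qed.

(** Each symmetry changes the sign of the operator and of the right-hand side, so the transformed
    solution solves the same equation; it again has zero line means, so uniqueness applies. *)
Lemma solution_symmetric (F : nat -> nat -> R -> R -> R) :
  solvable_family F -> antisymmetric3 (F 0%nat 0%nat) ->
  symmetric3 (solution F 0%nat 0%nat).
Proof.
  intros HF HA.
  pose proof (solvable_solution F HF) as HM.
  pose proof (fun x y => solution_eq F x y HF) as Heq.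
  remember (solution F) as M eqn:EM. clear EM.
  destruct HM as [HS [HP Hm]].
  pose proof (smooth_cont2 M 0 0 HS) as C0.
  destruct (Hm 0%nat 0%nat) as [Z1 [Z2 [Z3 Z4]]].
  assert (ZM : forall m n, resonant m n -> fourier_zero (M 0%nat 0%nat) m n)
    by (intros; apply line_means_fourier_zero; auto).
  assert (HN : forall u v, M 0%nat 0%nat (u - 2 * PI) v = M 0%nat 0%nat u v).
  { intros u v. rewrite <- (proj1 (HP 0%nat 0%nat (u - 2 * PI) v)). f_equal; ring. }
  assert (Sx : forall x y, M 0%nat 0%nat (- x) y = M 0%nat 0%nat x y).
  { intros x y.
    transitivity ((fun i j x y => (-1) ^ i * 1 ^ j * M i j (-1 * x + 0) (1 * y + 0))
      0%nat 0%nat x y).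
    { cbv beta. rewrite !pow_O, !Rmult_1_l, !Rplus_0_r. f_equal. ring. }
    assert (Cr : cont2 (fun x y => (-1) ^ 0 * 1 ^ 0 * M 0%nat 0%nat (-1 * x + 0) (1 * y + 0)))
      by cont2_tac.
    assert (Hline : forall a b, line_mean_zero (- a) b (M 0%nat 0%nat) ->
      line_mean_zero a b
        (fun x y => (-1) ^ 0 * 1 ^ 0 * M 0%nat 0%nat (-1 * x + 0) (1 * y + 0))).
    { intros a b H u v. refine (eq_trans _ (H (- u) v)). apply RInt_extR. intros s.
      rewrite !pow_O, !Rmult_1_l. f_equal; ring. }
    assert (Pr : periodic2
      (fun x y => (-1) ^ 0 * 1 ^ 0 * M 0%nat 0%nat (-1 * x + 0) (1 * y + 0))).
    { intros u v. rewrite !pow_O, !Rmult_1_l, !Rplus_0_r. split.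
      - rewrite <- (HN (-1 * u) v). f_equal. ring.
      - apply HP. }
    apply (solution_unique
      (fun i j x y => (-1) ^ i * 1 ^ j * M i j (-1 * x + 0) (1 * y + 0)) M); try assumption.
    - apply smooth_affine, HS.
    - intros m n Hmn. apply line_means_fourier_zero; try assumption; apply Hline.
      + rewrite <- Ropp_0. apply line_mean_zero_opp; assumption.
      + rewrite Ropp_0. exact Z2.
      + replace 1 with (- -1) at 2 by ring. apply line_mean_zero_opp; assumption.
      + apply line_mean_zero_opp; assumption.
    - apply HP.
    - intros u v. rewrite Heq. cbn [pow].
      replace (-1 * u + 0) with (- u) by ring. replace (1 * v + 0) with v by ring.
      rewrite <- (Ropp_involutive (F 0%nat 0%nat u v)), <- (proj1 (HA u v)), <- Heq. ring. }
  assert (Ss : forall x y, M 0%nat 0%nat y x = M 0%nat 0%nat x y).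
  { intros x y.
    change (M 0%nat 0%nat y x) with ((fun i j x y => M j i y x) 0%nat 0%nat x y).
    assert (Cr := cont2_swap _ C0).
    assert (Hline : forall a b, line_mean_zero b a (M 0%nat 0%nat) ->
      line_mean_zero a b (fun x y => M 0%nat 0%nat y x)).
    { intros a b H u v. exact (H v u). }
    assert (Pr : periodic2 (fun x y => M 0%nat 0%nat y x)).
    { intros u v. split; apply HP. }
    apply (solution_unique (fun i j x y => M j i y x) M); try assumption.
    - apply smooth_swap, HS.
    - intros m n Hmn. apply line_means_fourier_zero; try assumption; apply Hline; try assumption.
      replace 1 with (- -1) by ring. apply line_mean_zero_opp; assumption.
    - apply HP.
    - intros u v. rewrite Heq.
      rewrite <- (Ropp_involutive (F 0%nat 0%nat u v)), <- (proj2 (proj2 (HA u v))), <- Heq.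
      ring. }
  intros x y. split; [apply Sx | split; [|apply Ss]].
  (* The reflection in [y] is the reflection in [x] conjugated by the swap. *)
  rewrite <- Ss, Sx. apply Ss.
Qed.

(** * Cosine series *)

(** A telescoping comparison series of quadratic decay. *)
Lemma ex_series_inv_quadratic : ex_series (fun n => / (INR (S n) * INR (S (S n)))).
Proof.
  exists 1.
  assert (Hs : forall N, sum_n (fun n => / (INR (S n) * INR (S (S n)))) N
                         = 1 - / INR (S (S N))).
  { induction N as [|N IH].
    - rewrite sum_O. simpl. field.
    - rewrite sum_Sn, IH. rewrite !(S_INR (S _)), !S_INR.
      pose proof (pos_INR N).
      match goal with |- plus ?u ?v = ?w => change (u + v = w) end. field. lra. }
  change (is_lim_seq (sum_n (fun n => / (INR (S n) * INR (S (S n))))) 1).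
  apply (is_lim_seq_ext (fun N => 1 - / INR (S (S N)))); [intros; symmetry; apply Hs|].
  replace (Finite 1) with (Finite (1 - 0)) by (f_equal; ring).
  apply is_lim_seq_minus'; [apply is_lim_seq_const|].
  apply -> (is_lim_seq_incr_1 (fun n => / INR (S n))).
  apply -> (is_lim_seq_incr_1 (fun n => / INR n)).
  apply (is_lim_seq_inv INR p_infty); [apply is_lim_seq_INR | discriminate].
Qed.

Lemma rapid_decay_summable (a : nat -> R) (p : nat) :
  rapid_decay a -> ex_series (fun m => Rabs (a (S m)) * INR (S m) ^ p).
Proof.
  intros H. destruct (H (p + 2)%nat) as [C HC].
  apply (ex_series_le (K := R_AbsRing) (V := R_CompleteNormedModule) _
    (* The bound [C / t^2] with [t = INR (S n)] is at most [2 C / (t (t + 1))], because [t >= 1]. *)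
    (fun n => 2 * C * / (INR (S n) * INR (S (S n))))).
  - intros n. unfold norm; simpl. unfold abs; simpl.
    specialize (HC (S n)). rewrite pow_add in HC.
    assert (Hp : 0 < INR (S n)) by (apply lt_0_INR; lia).
    assert (Hp1 : 1 <= INR (S n)) by (rewrite <- INR_1; apply le_INR; lia).
    set (t := INR (S n)) in *.
    change (match n with O => 1 | S _ => INR n + 1 end) with t.
    change (t + 1) with (INR (S n) + 1). fold t.
    rewrite Rabs_pos_eq by (apply Rmult_le_pos; [apply Rabs_pos | apply pow_le; lra]).
    set (q := Rabs (a (S n)) * t ^ p).
    assert (Hq : q * (t * t) <= C) by (unfold q; simpl in HC; nra).
    assert (Hq0 : 0 <= q) by (apply Rmult_le_pos; [apply Rabs_pos | apply pow_le; lra]).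
    apply Rmult_le_reg_r with (t * (t + 1)); [nra|].
    replace (2 * C * / (t * (t + 1)) * (t * (t + 1))) with (2 * C) by (field; lra).
    assert (q * (t * (t + 1)) <= q * (2 * (t * t))) by (apply Rmult_le_compat_l; nra). lra.
  - apply (ex_series_scal_l (K := R_AbsRing) (V := R_NormedModule) (2 * C)),
      ex_series_inv_quadratic.
Qed.

Lemma sin_lipschitz (a b : R) : Rabs (sin b - sin a) <= Rabs (b - a).
Proof.
  destruct (MVT_gen sin a b cos) as [c [_ Hc]].
  - intros; apply is_derive_Reals, derivable_pt_lim_sin.
  - intros; apply continuity_sin.
  - rewrite Hc, Rabs_mult. rewrite <- (Rmult_1_l (Rabs (b - a))) at 2.
    apply Rmult_le_compat_r; [apply Rabs_pos|].
    apply Rabs_le_between. pose proof (COS_bound c). lra.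
Qed.

(** The mean value theorem for [cos (u + t) + t sin u], whose derivative [sin u - sin (u + t)] is at
    most [|t|] in absolute value. *)
Lemma cos_taylor_bound (u h : R) : Rabs (cos (u + h) - cos u + h * sin u) <= h * h.
Proof.
  assert (Hd : forall t, is_derive (fun t => cos (u + t) + t * sin u) t
    (sin u - sin (u + t))) by (intros t; auto_derive; [exact I | ring]).
  destruct (MVT_gen (fun t => cos (u + t) + t * sin u) 0 h (fun t => sin u - sin (u + t)))
    as [c [Hc E]].
  - intros; apply Hd.
  - intros t _. apply derivable_continuous_pt. eexists. apply is_derive_Reals, Hd.
  - rewrite Rplus_0_r, Rmult_0_l, Rplus_0_r, Rminus_0_r in E.
    replace (cos (u + h) - cos u + h * sin u) with (cos (u + h) + h * sin u - cos u) by ring.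
    rewrite E, Rabs_mult.
    replace (h * h) with (Rabs h * Rabs h)
      by (rewrite <- Rabs_mult; apply Rabs_pos_eq, Rle_0_sqr).
    apply Rmult_le_compat_r; [apply Rabs_pos|].
    eapply Rle_trans; [apply sin_lipschitz|].
    replace (u - (u + c)) with (- c) by ring. rewrite Rabs_Ropp.
    apply Rabs_le_between. unfold Rmin, Rmax in Hc.
    destruct (Rle_dec 0 h); [rewrite Rabs_pos_eq by lra | rewrite Rabs_left1 by lra]; lra.
Qed.

(** The [i]-th termwise derivative of the cosine series: each derivative advances the phase by
    [PI / 2], so no case distinction on [i] modulo 4 arises. *)
Definition cos_series (a : nat -> R) (i : nat) (x : R) : R :=
  Series (fun m => a (S m) * INR (S m) ^ i * cos (INR (S m) * x + INR i * (PI / 2))).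

Lemma ex_cos_series (a : nat -> R) (i : nat) (e : nat -> R) :
  rapid_decay a -> (forall m, Rabs (e m) <= 1) ->
  ex_series (fun m => a (S m) * INR (S m) ^ i * e m).
Proof.
  intros Ha He.
  apply (ex_series_le (K := R_AbsRing) (V := R_CompleteNormedModule) _
    (fun m => Rabs (a (S m)) * INR (S m) ^ i)); [|apply rapid_decay_summable, Ha].
  intros m. change (Rabs (a (S m) * INR (S m) ^ i * e m) <= Rabs (a (S m)) * INR (S m) ^ i).
  assert (0 <= INR (S m) ^ i) by (apply pow_le, pos_INR).
  rewrite !Rabs_mult, (Rabs_pos_eq (_ ^ _)) by assumption.
  rewrite <- (Rmult_1_r (Rabs (a (S m)) * INR (S m) ^ i)) at 2.
  apply Rmult_le_compat_l; [apply Rmult_le_pos; [apply Rabs_pos | assumption] | apply He].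
Qed.

Lemma Rabs_cos_le (t : R) : Rabs (cos t) <= 1.
Proof. apply Rabs_le_between, COS_bound. Qed.

(** The Taylor bound summed over all terms gives a remainder of at most [h^2 K], where [K] is finite
    by rapid decay; uniform convergence is not invoked. *)
Lemma is_derive_cos_series (a : nat -> R) (i : nat) (x : R) :
  rapid_decay a -> is_derive (cos_series a i) x (cos_series a (S i) x).
Proof.
  intros Ha. apply is_derive_Reals. intros eps Heps.
  set (K := Series (fun m => Rabs (a (S m)) * INR (S m) ^ (i + 2))).
  assert (HK : 0 <= K).
  { rewrite <- (Rmult_0_l K). unfold K. rewrite <- Series_scal_l. apply Series_le.
    - intros m. rewrite Rmult_0_l. split; [lra|].
      apply Rmult_le_pos; [apply Rabs_pos | apply pow_le, pos_INR].
    - apply rapid_decay_summable, Ha. }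
  assert (Hd : 0 < eps / (K + 1)) by (apply Rdiv_lt_0_compat; lra).
  exists (mkposreal _ Hd). intros h Hh Hlt. simpl in Hlt.
  assert (Ex : forall i x, ex_series (fun m =>
    a (S m) * INR (S m) ^ i * cos (INR (S m) * x + INR i * (PI / 2)))).
  { intros; apply ex_cos_series; [exact Ha | intros; apply Rabs_cos_le]. }
  assert (Hmain : Rabs (cos_series a i (x + h) - cos_series a i x - h * cos_series a (S i) x)
                  <= h * h * K).
  { unfold cos_series. rewrite <- Series_scal_l, <- Series_minus, <- Series_minus.
    - unfold K. rewrite <- Series_scal_l.
      assert (Hterm : forall m, Rabs
        (a (S m) * INR (S m) ^ i * cos (INR (S m) * (x + h) + INR i * (PI / 2))
         - a (S m) * INR (S m) ^ i * cos (INR (S m) * x + INR i * (PI / 2))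
         - h * (a (S m) * INR (S m) ^ S i * cos (INR (S m) * x + INR (S i) * (PI / 2))))
        <= h * h * (Rabs (a (S m)) * INR (S m) ^ (i + 2))).
      { intros m. rewrite (S_INR i). set (t := INR (S m)).
        assert (Ht : 0 <= t ^ i) by (apply pow_le, pos_INR).
        set (u := t * x + INR i * (PI / 2)).
        replace (t * x + (INR i + 1) * (PI / 2)) with (PI / 2 + u) by (unfold u; ring).
        replace (t * (x + h) + INR i * (PI / 2)) with (u + t * h) by (unfold u; ring).
        rewrite <- (Ropp_involutive (cos (PI / 2 + u))), <- sin_cos.
        replace (a (S m) * t ^ i * cos (u + t * h) - a (S m) * t ^ i * cos u
                 - h * (a (S m) * t ^ S i * - sin u))
          with (a (S m) * t ^ i * (cos (u + t * h) - cos u + t * h * sin u))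
          by (simpl; ring).
        replace (h * h * (Rabs (a (S m)) * t ^ (i + 2)))
          with (Rabs (a (S m)) * t ^ i * (t * h * (t * h))) by (rewrite pow_add; ring).
        rewrite !Rabs_mult, (Rabs_pos_eq (t ^ i)) by exact Ht.
        apply Rmult_le_compat_l; [apply Rmult_le_pos; [apply Rabs_pos | exact Ht]|].
        apply cos_taylor_bound. }
      assert (Eb : ex_series (fun m => h * h * (Rabs (a (S m)) * INR (S m) ^ (i + 2)))).
      { apply (ex_series_scal_l (K := R_AbsRing) (V := R_NormedModule) (h * h)).
        apply rapid_decay_summable, Ha. }
      eapply Rle_trans; [apply Series_Rabs|].
      + apply (ex_series_le (K := R_AbsRing) (V := R_CompleteNormedModule) _ _
          (fun m => Rle_trans _ _ _ (Req_le _ _ (Rabs_Rabsolu _)) (Hterm m)) Eb).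
      + apply Series_le; [|exact Eb]. intros m. split; [apply Rabs_pos | apply Hterm].
    - apply (ex_series_minus (K := R_AbsRing) (V := R_NormedModule)); apply Ex.
    - apply (ex_series_scal_l (K := R_AbsRing) (V := R_NormedModule) h), Ex.
    - apply Ex.
    - apply Ex. }
  replace ((cos_series a i (x + h) - cos_series a i x) / h - cos_series a (S i) x)
    with ((cos_series a i (x + h) - cos_series a i x - h * cos_series a (S i) x) / h)
    by (field; exact Hh).
  assert (Hh0 : 0 < Rabs h) by (apply Rabs_pos_lt, Hh).
  unfold Rdiv. rewrite Rabs_mult, Rabs_inv.
  apply Rmult_lt_reg_r with (Rabs h); [exact Hh0|].
  rewrite Rmult_assoc, Rinv_l, Rmult_1_r by lra.
  eapply Rle_lt_trans; [exact Hmain|].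
  replace (h * h) with (Rabs h * Rabs h)
    by (rewrite <- Rabs_mult; apply Rabs_pos_eq, Rle_0_sqr).
  rewrite Rmult_assoc, Rmult_comm. apply Rmult_lt_compat_r; [exact Hh0|].
  apply Rle_lt_trans with (eps / (K + 1) * K).
  - apply Rmult_le_compat_r; lra.
  - apply Rmult_lt_reg_r with (K + 1); [lra|].
    replace (eps / (K + 1) * K * (K + 1)) with (eps * K) by (field; lra). nra.
Qed.

Lemma continuous_cos_series (a : nat -> R) (i : nat) :
  rapid_decay a -> forall x, continuous (cos_series a i) x.
Proof.
  intros Ha x. apply (ex_derive_continuous (K := R_AbsRing) (V := R_NormedModule)).
  eexists. apply is_derive_cos_series, Ha.
Qed.

Lemma cos_series_periodic (a : nat -> R) (i : nat) (x : R) :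
  cos_series a i (x + 2 * PI) = cos_series a i x.
Proof.
  apply Series_ext. intros m. f_equal.
  replace (INR (S m) * (x + 2 * PI) + INR i * (PI / 2))
    with (INR (S m) * x + INR i * (PI / 2) + IZR (Z.of_nat (S m)) * (2 * PI))
    by (rewrite <- INR_IZR_INZ; ring).
  apply periodic_Z, cos_periodic.
Qed.

Lemma cos_series_even (a : nat -> R) (x : R) : cos_series a 0 (- x) = cos_series a 0 x.
Proof.
  apply Series_ext. intros m. f_equal. rewrite <- cos_neg. f_equal. simpl INR. ring.
Qed.

Lemma is_series_cos_series (a : nat -> R) (x : R) :
  rapid_decay a -> is_series (fun m => a (S m) * cos (INR (S m) * x)) (cos_series a 0 x).
Proof.
  intros Ha.
  apply (is_series_ext (fun m =>
    a (S m) * INR (S m) ^ 0 * cos (INR (S m) * x + INR 0 * (PI / 2)))).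
  - intros m. rewrite pow_O, Rmult_1_r. f_equal. f_equal. simpl INR. ring.
  - apply Series_correct, ex_cos_series; [exact Ha | intros; apply Rabs_cos_le].
Qed.

Definition axis_fam (a : nat -> R) (i j : nat) (x y : R) : R :=
  match j with O => cos_series a i x | S _ => 0 end.

(** Derivatives of a plane wave in [x + q y]: a derivative in [y] differs from one in [x] by the
    factor [q]. *)
Definition wave_fam (b : nat -> R) (q : R) (i j : nat) (x y : R) : R :=
  q ^ j * cos_series b (i + j) (x + q * y).

(* Derivative family of [sum a_m (cos mx + cos my) + sum b_m (cos m(x-y) + cos m(x+y))]. *)
Definition kernel_fam (a b : nat -> R) (i j : nat) (x y : R) : R :=
  (axis_fam a i j x y + axis_fam a j i y x)
  + (wave_fam b (-1) i j x y + wave_fam b 1 i j x y).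

Lemma smooth_axis_fam (a : nat -> R) : rapid_decay a -> smooth_family (axis_fam a).
Proof.
  intros Ha. apply smooth_family_intro; unfold axis_fam.
  - intros i [|j] x y; [apply is_derive_cos_series, Ha|].
    apply (is_derive_const (V := R_NormedModule)).
  - intros i [|j] x y; apply (is_derive_const (V := R_NormedModule)).
  - intros i [|j]; [|cont2_tac].
    pose proof (continuous_cos_series a i Ha). cont2_tac.
Qed.

Lemma smooth_wave_fam (b : nat -> R) (q : R) :
  rapid_decay b -> smooth_family (wave_fam b q).
Proof.
  intros Hb. apply smooth_family_intro; unfold wave_fam.
  - intros i j x y. apply is_derive_scal.
    pose proof (is_derive_comp (cos_series b (i + j)) (fun z => z + q * y) x _ 1
      (is_derive_cos_series b (i + j) (x + q * y) Hb)
      ltac:(auto_derive; [exact I | ring])) as H.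
    exact (eq_ind _ (is_derive _ x) H _ (Rmult_1_l _)).
  - intros i j x y.
    pose proof (is_derive_comp (cos_series b (i + j)) (fun z => x + q * z) y _ q
      (is_derive_cos_series b (i + j) (x + q * y) Hb)
      ltac:(auto_derive; [exact I | ring])) as H.
    apply (is_derive_scal _ _ (q ^ j)) in H.
    refine (eq_ind _ (is_derive _ y) H _ _).
    rewrite Nat.add_succ_r. unfold scal; simpl; unfold mult; simpl. ring.
  - intros i j. pose proof (continuous_cos_series b (i + j) Hb). cont2_tac.
Qed.

Lemma smooth_kernel_fam (a b : nat -> R) :
  rapid_decay a -> rapid_decay b -> smooth_family (kernel_fam a b).
Proof.
  intros Ha Hb.
  apply (smooth_add (fun i j x y => axis_fam a i j x y + axis_fam a j i y x)
    (fun i j x y => wave_fam b (-1) i j x y + wave_fam b 1 i j x y)).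
  - apply (smooth_add (axis_fam a) (fun i j x y => axis_fam a j i y x)).
    + apply smooth_axis_fam, Ha.
    + apply smooth_swap, smooth_axis_fam, Ha.
  - apply smooth_add; apply smooth_wave_fam, Hb.
Qed.

(** Mixed derivatives of the axis terms vanish; for the waves, [q^3 = q] when [q] is 1 or -1. *)
Lemma kernel_fam_eq (a b : nat -> R) (x y : R) :
  kernel_fam a b 3 1 x y - kernel_fam a b 1 3 x y = 0.
Proof. unfold kernel_fam, axis_fam, wave_fam. simpl. ring. Qed.

Lemma kernel_fam_00 (a b : nat -> R) (x y : R) :
  kernel_fam a b 0 0 x y =
  (cos_series a 0 x + cos_series a 0 y) + (cos_series b 0 (x - y) + cos_series b 0 (x + y)).
Proof.
  unfold kernel_fam, axis_fam, wave_fam. rewrite Nat.add_0_r, !pow_O, !Rmult_1_l.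
  replace (x + -1 * y) with (x - y) by ring. reflexivity.
Qed.

Lemma periodic_kernel_fam (a b : nat -> R) : periodic2 (kernel_fam a b 0%nat 0%nat).
Proof.
  intros x y. rewrite !kernel_fam_00.
  replace (x + 2 * PI - y) with (x - y + 2 * PI) by ring.
  replace (x + 2 * PI + y) with (x + y + 2 * PI) by ring.
  replace (x + (y + 2 * PI)) with (x + y + 2 * PI) by ring.
  rewrite <- (cos_series_periodic b 0 (x - (y + 2 * PI))).
  replace (x - (y + 2 * PI) + 2 * PI) with (x - y) by ring.
  rewrite !cos_series_periodic. split; reflexivity.
Qed.

Lemma symmetric_kernel_fam (a b : nat -> R) : symmetric3 (kernel_fam a b 0%nat 0%nat).
Proof.
  intros x y. rewrite !kernel_fam_00.
  replace (- x - y) with (- (x + y)) by ring.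
  replace (- x + y) with (- (x - y)) by ring.
  replace (x - - y) with (x + y) by ring.
  replace (x + - y) with (x - y) by ring.
  replace (y - x) with (- (x - y)) by ring.
  replace (y + x) with (x + y) by ring.
  rewrite !cos_series_even. repeat split; ring.
Qed.

Lemma is_cos_series_kernel_fam (a b : nat -> R) (f : R -> R -> R) :
  rapid_decay a -> rapid_decay b ->
  (forall x y, f x y = kernel_fam a b 0%nat 0%nat x y) -> is_cos_series a b f.
Proof.
  intros Ha Hb Hf x y.
  assert (Hsum : forall c u v, rapid_decay c ->
    infinite_sum (fun m => c (S m) * (cos (INR (S m) * u) + cos (INR (S m) * v)))
      (cos_series c 0 u + cos_series c 0 v)).
  { intros c u v Hc. apply is_series_Reals.
    apply (is_series_ext (fun m =>
      plus (c (S m) * cos (INR (S m) * u)) (c (S m) * cos (INR (S m) * v)))).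
    - intros m. match goal with |- plus ?u ?v = ?w => change (u + v = w) end. ring.
    - apply (is_series_plus (V := R_NormedModule)); apply is_series_cos_series, Hc. }
  exists (cos_series a 0 x + cos_series a 0 y),
    (cos_series b 0 (x - y) + cos_series b 0 (x + y)).
  split; [apply Hsum, Ha | split; [apply Hsum, Hb|]].
  rewrite Hf. apply kernel_fam_00.
Qed.

(** * The recursion *)

Lemma symmetric_family (F : nat -> nat -> R -> R -> R) (i j : nat) (x y : R) :
  smooth_family F -> symmetric3 (F 0%nat 0%nat) ->
  F i j (- x) y = (-1) ^ i * F i j x y /\ F i j x (- y) = (-1) ^ j * F i j x y /\
  F i j y x = F j i x y.
Proof.
  intros HF HS. split; [|split].
  - rewrite (smooth_family_unique F _ HF (smooth_affine (-1) 1 0 0 F HF)).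
    + rewrite pow1. replace (-1 * - x + 0) with x by ring.
      replace (1 * y + 0) with y by ring. ring.
    + intros u v. simpl. rewrite <- (proj1 (HS u v)), !Rmult_1_l. f_equal; ring.
  - rewrite (smooth_family_unique F _ HF (smooth_affine 1 (-1) 0 0 F HF)).
    + rewrite pow1. replace (-1 * - y + 0) with y by ring.
      replace (1 * x + 0) with x by ring. ring.
    + intros u v. simpl. rewrite <- (proj1 (proj2 (HS u v))), !Rmult_1_l. f_equal; ring.
  - apply (smooth_family_unique F _ HF (smooth_swap F HF)).
    intros u v. symmetry. apply HS.
Qed.

(** Arranged so that the entry [(0, 0)] is convertible with [Qop U V]. *)
Definition Qfam (U V : nat -> nat -> R -> R -> R) (i j : nat) (x y : R) : R :=
  prod_fam (shift_fam 1 1 U)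
    (fun i j x y => shift_fam 0 4 V i j x y - shift_fam 4 0 V i j x y) i j x y
  + 3 * (prod_fam (shift_fam 0 3 U) (shift_fam 1 2 V) i j x y
         - prod_fam (shift_fam 3 0 U) (shift_fam 2 1 V) i j x y)
  + 2 * (prod_fam (shift_fam 0 2 U) (shift_fam 1 3 V) i j x y
         - prod_fam (shift_fam 2 0 U) (shift_fam 3 1 V) i j x y).

Lemma smooth_Qfam (U V : nat -> nat -> R -> R -> R) :
  smooth_family U -> smooth_family V -> smooth_family (Qfam U V).
Proof.
  intros HU HV. unfold Qfam.
  apply (smooth_add (fun i j x y => _ + _) (fun i j x y => 2 * _)).
  - apply (smooth_add (prod_fam _ _) (fun i j x y => 3 * _)).
    + apply smooth_prod; [apply smooth_shift, HU|].
      apply smooth_sub; apply smooth_shift, HV.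
    + apply smooth_scal, smooth_sub; apply smooth_prod; apply smooth_shift; assumption.
  - apply smooth_scal, smooth_sub; apply smooth_prod; apply smooth_shift; assumption.
Qed.

Lemma periodic_Qop (U V : nat -> nat -> R -> R -> R) :
  smooth_family U -> smooth_family V ->
  periodic2 (U 0%nat 0%nat) -> periodic2 (V 0%nat 0%nat) -> periodic2 (Qop U V).
Proof.
  intros HU HV PU PV x y.
  pose proof (smooth_periodic U HU PU) as EU. pose proof (smooth_periodic V HV PV) as EV.
  unfold Qop. split.
  - rewrite !(fun i j => proj1 (EU i j x y)), !(fun i j => proj1 (EV i j x y)). reflexivity.
  - rewrite !(fun i j => proj2 (EU i j x y)), !(fun i j => proj2 (EV i j x y)). reflexivity.
Qed.

(** Every term of [Qop] carries an odd number of derivatives in [x] and an odd number in [y], and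
    the swap exchanges the two members of each difference. *)
Lemma antisymmetric_Qop (U V : nat -> nat -> R -> R -> R) :
  smooth_family U -> smooth_family V ->
  symmetric3 (U 0%nat 0%nat) -> symmetric3 (V 0%nat 0%nat) -> antisymmetric3 (Qop U V).
Proof.
  intros HU HV SU SV x y.
  pose proof (fun i j => symmetric_family U i j x y HU SU) as EU.
  pose proof (fun i j => symmetric_family V i j x y HV SV) as EV.
  unfold Qop. split; [|split].
  - rewrite !(fun i j => proj1 (EU i j)), !(fun i j => proj1 (EV i j)). simpl pow. ring.
  - rewrite !(fun i j => proj1 (proj2 (EU i j))), !(fun i j => proj1 (proj2 (EV i j))).
    simpl pow. ring.
  - rewrite !(fun i j => proj2 (proj2 (EU i j))), !(fun i j => proj2 (proj2 (EV i j))). ring.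
Qed.

Definition rhs_fam (L : nat -> nat -> nat -> R -> R -> R) (k i j : nat) (x y : R) : R :=
  sum_f_R0 (fun p => Qfam (L p) (L (k - p)%nat) i j x y) k.

Lemma rhs_fam_00 (L : nat -> nat -> nat -> R -> R -> R) (k : nat) (x y : R) :
  rhs_fam L k 0 0 x y = rhs L k x y.
Proof. reflexivity. Qed.

Definition good_family (F : nat -> nat -> R -> R -> R) : Prop :=
  smooth_family F /\ periodic2 (F 0%nat 0%nat) /\ symmetric3 (F 0%nat 0%nat).

Lemma solvable_rhs_fam (L : nat -> nat -> nat -> R -> R -> R) (k : nat) :
  (forall p, (p <= k)%nat -> good_family (L p)) ->
  solvable_family (rhs_fam L k) /\ antisymmetric3 (rhs_fam L k 0%nat 0%nat).
Proof.
  intros HL.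
  assert (HA : antisymmetric3 (rhs_fam L k 0%nat 0%nat)).
  { intros x y. rewrite !rhs_fam_00. unfold rhs.
    rewrite <- (Rmult_1_l (sum_f_R0 (fun p => Qop (L p) (L (k - p)%nat) x y) k)),
      Ropp_mult_distr_l, scal_sum.
    split; [|split]; apply sum_eq; intros p Hp;
      destruct (HL p ltac:(lia)) as [S1 [_ Y1]];
      destruct (HL (k - p)%nat ltac:(lia)) as [S2 [_ Y2]];
      destruct (antisymmetric_Qop _ _ S1 S2 Y1 Y2 x y) as [E1 [E2 E3]];
      rewrite ?E1, ?E2, ?E3; ring. }
  split; [|exact HA]. apply solvable_antisymmetric; [| |exact HA].
  - apply (smooth_sum (fun p => Qfam (L p) (L (k - p)%nat))). intros p Hp.
    apply smooth_Qfam; apply HL; lia.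
  - intros x y. rewrite !rhs_fam_00. unfold rhs.
    split; apply sum_eq; intros p Hp;
      destruct (HL p ltac:(lia)) as [S1 [P1 _]];
      destruct (HL (k - p)%nat ltac:(lia)) as [S2 [P2 _]];
      apply (periodic_Qop _ _ S1 S2 P1 P2).
Qed.

Definition next_fam (alphak betak : nat -> nat -> R) (k : nat)
    (P : nat -> nat -> nat -> R -> R -> R) : nat -> nat -> R -> R -> R :=
  fun i j x y =>
    solution (rhs_fam P k) i j x y + kernel_fam (alphak (S k)) (betak (S k)) i j x y.

(* [prefix n] agrees with [lambda_0, lambda_1, ...] up to index [n] and is junk above. *)
Fixpoint prefix (alpha beta : nat -> R) (alphak betak : nat -> nat -> R) (n : nat) :
    nat -> nat -> nat -> R -> R -> R :=
  match n with
  | O => fun _ => kernel_fam alpha beta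
  | S n => fun k =>
      if Nat.leb k n then prefix alpha beta alphak betak n k
      else next_fam alphak betak n (prefix alpha beta alphak betak n)
  end.

Definition lambda (alpha beta : nat -> R) (alphak betak : nat -> nat -> R) (k : nat) :
    nat -> nat -> R -> R -> R :=
  prefix alpha beta alphak betak k k.

Lemma prefix_lambda (alpha beta : nat -> R) (alphak betak : nat -> nat -> R) (n k : nat) :
  (k <= n)%nat -> prefix alpha beta alphak betak n k = lambda alpha beta alphak betak k.
Proof.
  induction n as [|n IH]; intros Hk.
  - replace k with 0%nat by lia. reflexivity.
  - destruct (Nat.eq_dec k (S n)) as [-> | Hne]; [reflexivity|].
    simpl. rewrite (proj2 (Nat.leb_le k n)) by lia. apply IH. lia.
Qed.

Lemma lambda_succ (alpha beta : nat -> R) (alphak betak : nat -> nat -> R) (k : nat) :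
  lambda alpha beta alphak betak (S k) =
  next_fam alphak betak k (prefix alpha beta alphak betak k).
Proof.
  change (lambda alpha beta alphak betak (S k)) with
    (if Nat.leb (S k) k then prefix alpha beta alphak betak k (S k)
     else next_fam alphak betak k (prefix alpha beta alphak betak k)).
  rewrite (proj2 (Nat.leb_gt (S k) k)) by lia. reflexivity.
Qed.

Lemma rhs_prefix (alpha beta : nat -> R) (alphak betak : nat -> nat -> R) (k : nat) (x y : R) :
  rhs (prefix alpha beta alphak betak k) k x y = rhs (lambda alpha beta alphak betak) k x y.
Proof. apply sum_eq. intros p Hp. rewrite !prefix_lambda by lia. reflexivity. Qed.

Lemma good_lambda (alpha beta : nat -> R) (alphak betak : nat -> nat -> R) :
  rapid_decay alpha -> rapid_decay beta ->
  (forall k, (1 <= k)%nat -> rapid_decay (alphak k)) ->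
  (forall k, (1 <= k)%nat -> rapid_decay (betak k)) ->
  forall k, good_family (lambda alpha beta alphak betak k).
Proof.
  intros Ha Hb Hak Hbk k.
  induction k as [[|k] IH] using lt_wf_ind.
  - split; [|split].
    + apply smooth_kernel_fam; assumption.
    + apply periodic_kernel_fam.
    + apply symmetric_kernel_fam.
  - rewrite lambda_succ.
    destruct (solvable_rhs_fam (prefix alpha beta alphak betak k) k) as [HF HA].
    { intros p Hp. rewrite prefix_lambda by exact Hp. apply IH. lia. }
    pose proof (solution_symmetric _ HF HA) as HSy.
    destruct (solvable_solution _ HF) as [HS [HP _]].
    pose proof (periodic_kernel_fam (alphak (S k)) (betak (S k))) as HPk.
    pose proof (symmetric_kernel_fam (alphak (S k)) (betak (S k))) as HSk.
    split; [|split].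
    + apply smooth_add; [exact HS|]. apply smooth_kernel_fam; [apply Hak | apply Hbk]; lia.
    + intros x y. unfold next_fam.
      destruct (HP 0%nat 0%nat x y) as [E1 E2]. destruct (HPk x y) as [E3 E4].
      rewrite E1, E2, E3, E4. split; reflexivity.
    + intros x y. unfold next_fam.
      destruct (HSy x y) as [E1 [E2 E3]]. destruct (HSk x y) as [E4 [E5 E6]].
      rewrite E1, E2, E3, E4, E5, E6. repeat split.
Qed.

Theorem theorem7
  (alpha beta : nat -> R) (alphak betak : nat -> nat -> R)
  (Ha : rapid_decay alpha) (Hb : rapid_decay beta)
  (Hak : forall k, (1 <= k)%nat -> rapid_decay (alphak k))
  (Hbk : forall k, (1 <= k)%nat -> rapid_decay (betak k)) :
  exists L : nat -> nat -> nat -> R -> R -> R,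
    (forall k, smooth_family (L k) /\ periodic2 (L k 0%nat 0%nat)
               /\ symmetric3 (L k 0%nat 0%nat)) /\
    is_cos_series alpha beta (L 0%nat 0%nat 0%nat) /\
    forall k : nat,
      periodic2 (rhs L k) /\
      (forall m : Z, fourier_zero (rhs L k) m 0 /\ fourier_zero (rhs L k) 0 m /\
                     fourier_zero (rhs L k) m m /\ fourier_zero (rhs L k) m (- m)) /\
      (forall x y, L (S k) 3%nat 1%nat x y - L (S k) 1%nat 3%nat x y = rhs L k x y) /\
      (exists M : nat -> nat -> R -> R -> R,
         smooth_family M /\ periodic2 (M 0%nat 0%nat) /\
         (forall m n, resonant m n -> fourier_zero (M 0%nat 0%nat) m n) /\
         (forall x y, M 3%nat 1%nat x y - M 1%nat 3%nat x y = rhs L k x y) /\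
         (forall G : nat -> nat -> R -> R -> R,
            smooth_family G -> periodic2 (G 0%nat 0%nat) ->
            (forall m n, resonant m n -> fourier_zero (G 0%nat 0%nat) m n) ->
            (forall x y, G 3%nat 1%nat x y - G 1%nat 3%nat x y = rhs L k x y) ->
            forall x y, G 0%nat 0%nat x y = M 0%nat 0%nat x y) /\
         is_cos_series (alphak (S k)) (betak (S k))
           (fun x y => L (S k) 0%nat 0%nat x y - M 0%nat 0%nat x y)).
Proof.
  pose (L := lambda alpha beta alphak betak).
  assert (HL : forall k, good_family (L k)) by (intros; apply good_lambda; assumption).
  exists L. split; [exact HL|]. split.
  { apply is_cos_series_kernel_fam; [exact Ha | exact Hb | reflexivity]. }
  intros k.
  destruct (solvable_rhs_fam L k) as [HF _]; [intros; apply HL|].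
  (* The recursion builds [M] from [prefix], while the equation speaks of [L]; the two agree at all
     indices up to [k], the only ones in the sum. *)
  destruct (solvable_rhs_fam (prefix alpha beta alphak betak k) k) as [HFp _].
  { intros p Hp. rewrite prefix_lambda by exact Hp. apply HL. }
  set (M := solution (rhs_fam (prefix alpha beta alphak betak k) k)).
  assert (HM : solvable_family M) by (apply solvable_solution, HFp).
  assert (EM : forall x y, M 3%nat 1%nat x y - M 1%nat 3%nat x y = rhs L k x y).
  { intros x y. unfold M. rewrite solution_eq by exact HFp.
    rewrite rhs_fam_00. apply rhs_prefix. }
  assert (EL : forall i j x y, L (S k) i j x y =
    M i j x y + kernel_fam (alphak (S k)) (betak (S k)) i j x y).
  { intros i j x y. unfold L. rewrite lambda_succ. reflexivity. }
  clearbody M.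
  assert (ZM : forall m n, resonant m n -> fourier_zero (M 0%nat 0%nat) m n).
  { intros m n. apply solvable_fourier_zero, HM. }
  destruct HM as [HS [HP _]].
  split; [exact (proj1 (proj2 HF) 0%nat 0%nat)|]. split.
  { intros m.
    split; [|split; [|split]]; apply (solvable_fourier_zero (rhs_fam L k) 0 0 _ _ HF);
      unfold resonant; ring. }
  split.
  { intros x y. rewrite !EL.
    pose proof (kernel_fam_eq (alphak (S k)) (betak (S k)) x y). specialize (EM x y). lra. }
  exists M. split; [exact HS|]. split; [apply HP|]. split; [exact ZM|]. split; [exact EM|].
  split.
  - intros G HG PG ZG EG. apply solution_unique; try assumption.
    + apply HP.
    + intros x y. rewrite EG, EM. reflexivity.
  - apply is_cos_series_kernel_fam; [apply Hak; lia | apply Hbk; lia |].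
    intros x y. rewrite EL. ring.
Qed.
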